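(* Assume $[E:k]$ is odd, so $\Delta:=E\otimes_kD$ is a division algebra. Let $\phi:E\to A$ be a $\sigma'$-$\sigma$-equivariant $k$-algebra monomorphism, making $V$ a right $\Delta$-vector space, and let $M$ be an $o_D$-lattice of $V$ which is an $o_\Delta$-lattice for this structure. Then $M^{\#,h}=M^{\#,h^\phi}$, where $M^{\#,h}=\{v\in V: h(v,M)\subseteq\mathfrak p_D\}$ and $M^{\#,h^\phi}=\{v\in V: h^\phi(v,M)\subseteq\mathfrak p_\Delta\}$.
   Context: $k$ is a non-Archimedean local field of odd residue characteristic; $D$ a central division algebra over $k$ of index $d$; $V$ a finite-dimensional right $D$-vector space, $A=\mathrm{End}_D(V)$. $\rho$ is an anti-automorphism of $D$ with $\rho^2=\mathrm{id}$, $k_0$ its fixed field in $k$, $\epsilon\in\{\pm1\}$, $h:V\times V\to D$ a non-degenerate $\epsilon$-Hermitian form ($h(va,wb)=\rho(a)h(v,w)b$, $h(w,v)=\epsilon\rho(h(v,w))$) with adjoint involution $\sigma$ on $A$. $E|k$ is a finite field extension, $\sigma'$ an automorphism of $E$ of order at most two extending $\rho|_k$, $E_0$ its fixed field; $\lambda:E\to k$ is a non-zero $k$-linear map with $\lambda\circ\sigma'=\rho\circ\lambda$ and $\mathfrak p_{E_0}=\{x\in E_0:\lambda(xo_{E_0})\subseteq\mathfrak p_{k_0}\}$; $\tilde\lambda:E\otimes_kD\to D$, $x\otimes y\mapsto\lambda(x)y$. $\phi$ is $\sigma'$-$\sigma$-equivariant if $\phi(\sigma'(x))=\sigma(\phi(x))$.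 $h^\phi:V\times V\to E\otimes_kD$ is the unique bi-additive map with $h^\phi(va,wb)=(\sigma'\otimes\rho)(a)h^\phi(v,w)b$, $(\sigma'\otimes\rho)(h^\phi(v,w))=\epsilon h^\phi(w,v)$ and $\tilde\lambda\circ h^\phi=h$. *)

(* Defs.v *)
From HB Require Import structures.
From mathcomp Require Import all_boot all_order all_algebra all_field.
Set Implicit Arguments. Unset Strict Implicit. Unset Printing Implicit Defensive.
Import Order.TTheory GRing.Theory Num.Theory.
Local Open Scope ring_scope.

Section Val.
Variables (k : fieldType) (v : k -> int).

(* valuation ring o_k and maximal ideal p_k (v is only meaningful on k^x) *)
Definition val_ring (x : k) : Prop := x = 0 \/ (0 <= v x)%R.
Definition val_ideal (x : k) : Prop := x = 0 \/ (0 < v x)%R.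

Definition val_close (n : int) (x y : k) : Prop :=
  x = y \/ (n <= v (x - y))%R.

Definition val_cauchy (u : nat -> k) : Prop :=
  forall n : int, exists N : nat, forall m p : nat,
    (N <= m)%N -> (N <= p)%N -> val_close n (u m) (u p).

Definition val_converges (u : nat -> k) (l : k) : Prop :=
  forall n : int, exists N : nat, forall m : nat, (N <= m)%N -> val_close n (u m) l.

Definition nonarch_local_field_odd : Prop :=
  (forall x y, x != 0 -> y != 0 -> v (x * y) = (v x + v y)%R) /\
  (forall x y, x != 0 -> y != 0 -> x + y != 0 ->
        (Order.min (v x) (v y) <= v (x + y))%R) /\
  (forall n : int, exists x, x != 0 /\ v x = n) /\
  (forall u : nat -> k, val_cauchy u -> exists l, val_converges u l) /\
  (exists s : seq k, (forall y, y \in s -> val_ring y) /\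
         (forall x, val_ring x -> exists2 y, y \in s & val_ideal (x - y))) /\
  ~ val_ideal 2%:R.

(* ---------- valuation ring / maximal ideal of a finite dimensional
   k-algebra (used for E, D and Delta = E (x)_k D): the elements integral
   over o_k, and its non-units. ---------- *)
Definition int_ring (R : falgType k) (x : R) : Prop :=
  exists p : {poly k}, [/\ p \is monic, forall i, val_ring p`_i &
                           root (map_poly (in_alg R) p) x].

Definition int_ideal (R : falgType k) (x : R) : Prop :=
  int_ring x /\ ~ (x \is a GRing.unit /\ int_ring x^-1).
End Val.

Definition is_lattice (R : nzRingType) (V : zmodType) (act : V -> R -> V)
    (O : R -> Prop) (M : V -> Prop) : Prop :=
  exists s : seq V,
    (forall x, M x <-> exists a : nat -> R, (forall i, O (a i)) /\
         x = \sum_(i < size s) act s`_i (a i)) /\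
    (forall x, exists b : nat -> R, x = \sum_(i < size s) act s`_i (b i)).

Definition dual_lattice (R : Type) (V : Type) (h : V -> V -> R)
    (P : R -> Prop) (M : V -> Prop) (x : V) : Prop :=
  forall m, M m -> P (h x m).

(* Main.v *)
Require Import Defs.
From Stdlib Require Import Classical IndefiniteDescription.
From HB Require Import structures.
From mathcomp Require Import all_boot all_order all_fingroup all_algebra all_solvable all_field.
From mathcomp Require Import zify.
Set Implicit Arguments. Unset Strict Implicit. Unset Printing Implicit Defensive.
Import Order.TTheory GRing.Theory Num.Theory VectorInternalTheory.
Local Open Scope ring_scope.

(** Every finite-dimensional division algebra R over k carries the valuation
    v(det(right multiplication)); compactness of the integers of k makes it
    non-Archimedean, and its integers are exactly the elements integral over
    o_k.

    The involution forces D to be small. Let zeta be a Teichmueller generator of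
    the residue field of D and Pi a uniformizer with Pi zeta = zeta^r Pi. Since
    rho preserves the valuation and induces a power map on the (commutative)
    residue field, reversing products in this relation gives zeta^(r^2) = zeta.
    Hence Pi^2, zeta + zeta^r and zeta^(1+r) are central, so dim D <= 4, and
    Delta is a division algebra because the dimension of a left ideal is
    divisible by the coprime numbers [E:k] and dim D.

    Averaging x |-> g x g^-1 over the 2N elements g = Pi^j zeta^i maps D to k,
    Delta to E and p_Delta to p_E. If z in p_Delta had lambda~(z) outside p_D,
    we could scale z so that lambda~(z) = 1, and averaging would yield e in p_E
    with lambda(e) = 2N, a unit of o_k; but lambda(p_E) is contained in p_k.
    Conversely, if h(x, M) is in p_D and z = h^phi(x, m) is not in p_Delta, then
    m z^-1 y lies in M for all y in o_E, so that lambda(y) = h(x, m z^-1 y) is in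
    p_k, contradicting the normalisation of lambda. *)

(** * Valuations on possibly non-commutative rings *)

(** The number [w 0] carries no information, so zero is put into every level by hand; for a
    valuation each level is then an additive subgroup. *)
Definition vge (R : nzRingType) (w : R -> int) (j : int) (x : R) : bool :=
  (x == 0) || (j <= w x).

Definition valuative (R : nzRingType) (w : R -> int) : Prop :=
  [/\ forall x y, x != 0 -> y != 0 -> x * y != 0 /\ w (x * y) = w x + w y
    & forall j x y, vge w j x -> vge w j y -> vge w j (x + y)].

Section Valuative.
Variables (R : nzRingType) (w : R -> int).
Hypothesis wP : valuative w.
Implicit Types x y z : R.

Lemma vge0 (j : int) : vge w j 0. Proof. by rewrite /vge eqxx. Qed.

Lemma vgeD j x y : vge w j x -> vge w j y -> vge w j (x + y).
Proof. by case: wP => _; apply. Qed.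

Lemma wM x y : x != 0 -> y != 0 -> w (x * y) = w x + w y.
Proof. by case: wP => h _ hx hy; case: (h x y hx hy). Qed.

Lemma val_mulf_neq0 (x y : R) : x != 0 -> y != 0 -> x * y != 0.
Proof. by case: wP => h _ hx hy; case: (h x y hx hy). Qed.

Lemma w1 : w 1 = 0.
Proof.
have : w 1 = w 1 + w 1 by rewrite -wM ?oner_neq0 // mulr1.
lia.
Qed.

Lemma wN1 : w (-1) = 0.
Proof.
have h1 : (-1 : R) != 0 by rewrite oppr_eq0 oner_neq0.
by have := wM h1 h1; rewrite mulrNN mulr1 w1; lia.
Qed.

Lemma wN x : w (- x) = w x.
Proof.
have [->|hx] := eqVneq x 0; first by rewrite oppr0.
by rewrite -mulN1r wM ?oppr_eq0 ?oner_neq0 // wN1 add0r.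
Qed.

Lemma wX x n : x != 0 -> x ^+ n != 0 /\ w (x ^+ n) = w x *+ n.
Proof.
move=> hx; elim: n => [|n [h1 h2]]; first by rewrite expr0 oner_neq0 w1.
by rewrite exprS val_mulf_neq0 // wM // h2 mulrS.
Qed.

Lemma vgeN j x : vge w j (- x) = vge w j x.
Proof. by rewrite /vge oppr_eq0 wN. Qed.

Lemma vgeB j x y : vge w j x -> vge w j y -> vge w j (x - y).
Proof. by move=> hx hy; apply: vgeD => //; rewrite vgeN. Qed.

Lemma vgeBC j x y : vge w j (x - y) = vge w j (y - x).
Proof. by rewrite -vgeN opprB. Qed.

Lemma vge_trans j x y z : vge w j (x - y) -> vge w j (y - z) -> vge w j (x - z).
Proof. by move=> h1 h2; have := vgeD h1 h2; rewrite addrA subrK. Qed.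

Lemma vgeM i j x y : vge w i x -> vge w j y -> vge w (i + j) (x * y).
Proof.
rewrite /vge; have [->|hx] := eqVneq x 0; first by rewrite mul0r eqxx.
have [->|hy] := eqVneq y 0; first by rewrite mulr0 eqxx.
by move=> /= h1 h2; rewrite wM //; apply/orP; right; lia.
Qed.

Lemma vge_le i j x : (i <= j) -> vge w j x -> vge w i x.
Proof. by rewrite /vge => h /orP[->//|h']; apply/orP; right; lia. Qed.

Lemma vge1 : vge w 0 1. Proof. by rewrite /vge w1 lexx orbT. Qed.

Lemma vge_ge j x : x != 0 -> vge w j x = (j <= w x).
Proof. by rewrite /vge => /negPf->. Qed.

Lemma vge_sum j (I : Type) (r : seq I) (P : pred I) (F : I -> R) :
  (forall i, P i -> vge w j (F i)) -> vge w j (\sum_(i <- r | P i) F i).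
Proof. by move=> h; elim/big_ind: _ => //; [exact: vge0|exact: vgeD]. Qed.

Lemma vgeMn j x n : vge w j x -> vge w j (x *+ n).
Proof.
by move=> h; elim: n => [|n IH]; rewrite ?mulr0n ?vge0 // mulrS vgeD.
Qed.

Lemma vge_nat n : vge w 0 (n%:R). Proof. exact/vgeMn/vge1. Qed.

Lemma vgeX x n : vge w 0 x -> vge w 0 (x ^+ n).
Proof.
move=> h; elim: n => [|n IH]; first exact: vge1.
by rewrite exprS -[0]addr0 vgeM.
Qed.

Lemma vgeM0l j x y : vge w 0 x -> vge w j y -> vge w j (x * y).
Proof. by move=> h1 h2; rewrite -[j]add0r vgeM. Qed.

Lemma vgeM0r j x y : vge w j x -> vge w 0 y -> vge w j (x * y).
Proof. by move=> h1 h2; rewrite -[j]addr0 vgeM. Qed.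

Lemma vge_eq0 x : (forall n : nat, vge w n%:Z x) -> x = 0.
Proof.
move=> h; apply/eqP; apply: contraT => hx.
by move: (h (absz (w x)).+1); rewrite vge_ge //; lia.
Qed.

Lemma vgeM_inv i j x y : x != 0 -> w x = i -> vge w (i + j) (x * y) -> vge w j y.
Proof.
move=> hx wx; have [->|hy] := eqVneq y 0; first by rewrite vge0.
by rewrite !vge_ge ?val_mulf_neq0 // wM // wx; lia.
Qed.

Lemma vgeM_invr i j x y : x != 0 -> w x = i -> vge w (j + i) (y * x) -> vge w j y.
Proof.
move=> hx wx; have [->|hy] := eqVneq y 0; first by rewrite vge0.
by rewrite !vge_ge ?val_mulf_neq0 // wM // wx; lia.
Qed.

(** The ultrametric inequality, used for y = x - (x - y) and again for x = y + (x - y), leaves no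
    other value for y. *)
Lemma w_close x y : x != 0 -> vge w (w x + 1) (x - y) -> y != 0 /\ w y = w x.
Proof.
move=> hx h.
have hy : y != 0.
  by apply: contraTneq h => ->; rewrite subr0 vge_ge //; lia.
split=> //.
have : vge w (w x) y.
  have -> : y = x - (x - y) by rewrite opprB addrC subrK.
  by apply: vgeB; [rewrite vge_ge|apply: vge_le h; lia].
rewrite vge_ge // => h1.
have [//|h2] := eqVneq (w y) (w x).
have : vge w (w x + 1) x.
  suff : vge w (w x + 1) (y + (x - y)) by rewrite [y + _]addrC subrK.
  by apply: vgeD => //; rewrite vge_ge // lezD1 lt_neqAle eq_sym h2.
by rewrite vge_ge //; lia.
Qed.

Lemma vgeXB (m : int) x y n : vge w 0 x -> vge w 0 y -> vge w m (x - y) ->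
  vge w m (x ^+ n - y ^+ n).
Proof.
move=> hx hy h; elim: n => [|n IH]; first by rewrite subrr vge0.
rewrite !exprS.
have -> : x * x ^+ n - y * y ^+ n = (x - y) * x ^+ n + y * (x ^+ n - y ^+ n).
  by rewrite mulrBl mulrBr addrA subrK.
by apply: vgeD; [apply: vgeM0r => //; exact: vgeX|exact: vgeM0l].
Qed.

Lemma vgeMB (m : int) x y x' y' : vge w 0 x -> vge w 0 y' ->
  vge w m (x - y) -> vge w m (x' - y') -> vge w m (x * x' - y * y').
Proof.
move=> hx hy' h h'.
have -> : x * x' - y * y' = x * (x' - y') + (x - y) * y'.
  by rewrite mulrBl mulrBr addrA subrK.
by apply: vgeD; [exact: vgeM0l|exact: vgeM0r].
Qed.

Lemma vge_close (m : int) x y : vge w m (x - y) -> vge w m x -> vge w m y.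
Proof. by move=> h hx; rewrite -(subKr x y); apply: vgeB. Qed.

End Valuative.

(** * Sequential compactness of the integers of k *)

Section LocalField.
Variables (k : fieldType) (v : k -> int).
Hypothesis Hk : nonarch_local_field_odd v.
Implicit Types x y z : k.

Lemma local_valuative : valuative v.
Proof.
case: Hk => hM [hD _]; split=> [x y hx hy|j x y].
  by rewrite mulf_neq0 // hM.
rewrite /vge; have [->|hx] := eqVneq x 0; first by rewrite add0r.
have [->|hy] := eqVneq y 0; first by rewrite addr0 (negPf hx).
have [//|hxy] := eqVneq (x + y) 0.
by move=> /= h1 h2; apply: le_trans (hD x y hx hy hxy); rewrite le_min h1.
Qed.
Let vP := local_valuative.

Lemma exists_val (n : int) : exists2 x, x != 0 & v x = n.
Proof. by case: Hk => _ [_ [h _]]; have [x [h1 h2]] := h n; exists x. Qed.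

Lemma val_ringP x : val_ring v x <-> vge v 0 x.
Proof.
rewrite /val_ring /vge; split=> [[->|->]|/orP[/eqP->|]]; rewrite ?eqxx ?orbT //; by [left|right].
Qed.

Lemma val_idealP x : val_ideal v x <-> vge v 1 x.
Proof.
rewrite /val_ideal /vge; split=> [[->|h]|/orP[/eqP->|h]]; rewrite ?eqxx ?orbT //.
- by apply/orP; right; lia.
- by left.
- by right; lia.
Qed.

Lemma val_closeP n x y : val_close v n x y <-> vge v n (x - y).
Proof.
rewrite /val_close /vge subr_eq0; split=> [[->|h]|/orP[/eqP->|h]].
- by rewrite eqxx.
- by rewrite h orbT.
- by left.
- by right.
Qed.

Lemma two_notin_ideal : ~~ vge v 1 2%:R.
Proof. by case: Hk => _ [_ [_ [_ [_ h]]]]; apply/negP => /val_idealP. Qed.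

Definition infinitely_often (P : nat -> Prop) := forall n, exists2 j, (n <= j)%N & P j.

(** Pigeonhole principle: if [a] occurs only finitely often, the remaining indices are covered by
    the rest of the list. *)
Lemma infinitely_often_seq (T : eqType) (s : seq T) (P : nat -> Prop)
    (Q : T -> nat -> Prop) :
  infinitely_often P -> (forall j, P j -> exists2 y, y \in s & Q y j) ->
  exists2 y, y \in s & infinitely_often (Q y).
Proof.
elim: s P => [|a s IH] P hP hQ.
  by have [j _ Pj] := hP 0%N; have [y] := hQ _ Pj.
have [ha|ha] := classic (infinitely_often (Q a)).
  by exists a; rewrite ?mem_head.
have [n hn] : exists n, forall j, (n <= j)%N -> ~ Q a j.
  apply: NNPP => h; apply: ha => n; apply: NNPP => h'; apply: h; exists n.
  by move=> j hj Qj; apply: h'; exists j.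
have [||y ys hy] := IH (fun j => (n <= j)%N /\ P j).
- move=> m; have [j hj Pj] := hP (maxn n m); exists j; first by lia.
  by split=> //; lia.
- move=> j [hj Pj]; have [y] := hQ _ Pj.
  by rewrite inE => /orP[/eqP->|ys Qy]; [move/(hn _ hj)|exists y].
by exists y; rewrite ?inE ?ys ?orbT.
Qed.

Lemma infinitely_often_subseq (P : nat -> nat -> Prop) :
  (forall m, infinitely_often (P m)) ->
  exists2 phi : nat -> nat, {homo phi : m n / (m < n)%N} & forall m, P m (phi m).
Proof.
move=> hP.
have /functional_choice[f hf] : forall mn : nat * nat, exists j, (mn.2 <= j)%N /\ P mn.1 j.
  by move=> [m n]; have [j h1 h2] := hP m n; exists j.
pose phi := fix phi m := if m is m'.+1 then f (m, (phi m').+1) else f (0, 0)%N.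
exists phi; last by case=> [|m]; [case: (hf (0, 0)%N)|case: (hf (m.+1, (phi m).+1))].
apply: homo_ltn => [|m]; first exact: ltn_trans.
by case: (hf (m.+1, (phi m).+1)).
Qed.

Lemma homo_ltn_ge (phi : nat -> nat) m : {homo phi : m n / (m < n)%N} -> (m <= phi m)%N.
Proof.
move=> h; elim: m => // m IH; apply: leq_ltn_trans IH _; exact: h.
Qed.

(** A ball c + t^m o_k splits into finitely many balls of level m + 1, one of which contains
    infinitely many terms again. The centres of the nested balls form a Cauchy sequence, and
    completeness provides its limit. *)
Lemma local_seq_compact (u : nat -> k) : (forall j, vge v 0 (u j)) ->
  exists2 phi : nat -> nat, {homo phi : m n / (m < n)%N} &
  exists l, forall m : nat, vge v m%:Z (u (phi m) - l).
Proof.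
move=> hu.
have [_ [_ [_ [hC [[s [_ hs]] _]]]]] := Hk.
have [t t0 vt] := exists_val 1.
have vt_ n : t ^+ n != 0 /\ v (t ^+ n) = n%:Z.
  by have [h1 ->] := wX vP n t0; split=> //; rewrite vt; lia.
pose I m c := infinitely_often (fun j => vge v m%:Z (u j - c)).
have step m c : I m c -> exists c', vge v m%:Z (c' - c) /\ I m.+1 c'.
  move=> hI; have [tm vtm] := vt_ m.
  (* Replacing a non-integral y by 0 keeps the new centre congruent to c modulo t^m, whichever
     element of the list is picked. *)
  have [j hj|y ys hy] := @infinitely_often_seq _ s _
      (fun y j => vge v m.+1%:Z (u j - (c + t ^+ m * (if vge v 0 y then y else 0)))) hI.
    have hz : vge v 0 ((u j - c) / t ^+ m).
      by apply: (@vgeM_invr _ _ vP _ _ _ _ tm vtm); rewrite add0r divfK.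
    have [y ys /val_idealP hy] := hs _ (proj2 (val_ringP _) hz).
    exists y => //.
    have hy0 : vge v 0 y by apply: vge_close hz => //; apply: vge_le hy.
    rewrite hy0 opprD addrA.
    have -> : u j - c - t ^+ m * y = t ^+ m * ((u j - c) / t ^+ m - y).
      by rewrite mulrBr mulrCA divff // mulr1.
    have -> : m.+1%:Z = m%:Z + 1 by lia.
    by apply: vgeM => //; rewrite vge_ge // vtm.
  exists (c + t ^+ m * (if vge v 0 y then y else 0)); split=> //.
  rewrite addrAC subrr add0r -[m%:Z]addr0; apply: vgeM => //; first by rewrite vge_ge // vtm.
  by case: ifP => // _; exact: vge0.
have /functional_choice[f hf] : forall mc : nat * k, exists c',
    I mc.1 mc.2 -> vge v mc.1%:Z (c' - mc.2) /\ I mc.1.+1 c'.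
  move=> [m c]; have [h|h] := classic (I m c); last by exists 0.
  by have [c' hc'] := step _ _ h; exists c'.
pose cs := fix cs m := if m is m'.+1 then f (m', cs m') else 0.
have hI m : I m (cs m).
  elim: m => [|m IH]; first by move=> n; exists n; rewrite ?subr0.
  by have [] := hf (m, cs m) IH.
have hcs m i : (m <= i)%N -> vge v m%:Z (cs i - cs m).
  elim: i => [|i IH]; first by rewrite leqn0 => /eqP->; rewrite subrr vge0.
  rewrite leq_eqVlt => /orP[/eqP->|]; first by rewrite subrr vge0.
  rewrite ltnS => hmi; have [h _] := hf (i, cs i) (hI i).
  apply: (vge_trans vP _ (IH hmi)); apply: vge_le h; rewrite /=; lia.
have [n|l hl] := hC cs.
  exists (absz n) => i j hi hj; apply/val_closeP.
  apply: (@vge_le _ _ _ (absz n)%:Z); first by lia.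
  by apply: (@vge_trans _ _ vP _ _ (cs (absz n))); last rewrite vgeBC //; exact: hcs.
have hl' m : vge v m%:Z (cs m - l).
  have [N hN] := hl m%:Z; have /val_closeP h := hN (maxn N m) (leq_maxl _ _).
  by apply: (vge_trans vP _ h); rewrite vgeBC //; apply: hcs; exact: leq_maxr.
have [phi h1 h2] := infinitely_often_subseq hI.
exists phi => //; exists l => m; exact: vge_trans (h2 m) (hl' m).
Qed.

(** Coordinates are treated one at a time, each refining the subsequence found so far; a factor t of
    value C makes the coordinate integral. *)
Lemma local_seq_compact_row n (u : nat -> 'rV[k]_n) (C : nat) :
  (forall j i, vge v (- C%:Z) (u j 0 i)) ->
  exists2 phi : nat -> nat, {homo phi : m n / (m < n)%N} &
  exists l : 'rV[k]_n, forall (m : nat) i, vge v m%:Z (u (phi m) 0 i - l 0 i).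
Proof.
move=> hu.
suff [phi h [l hl]] : exists2 phi : nat -> nat, {homo phi : m n / (m < n)%N} &
    exists l : 'I_n -> k, forall (m : nat) i, i \in enum 'I_n -> vge v m%:Z (u (phi m) 0 i - l i).
  exists phi => //; exists (\row_i l i) => m i; rewrite mxE; apply: hl.
  by rewrite mem_enum.
elim: (enum 'I_n) => [|i0 s [phi hphi [l hl]]].
  by exists id => //; exists (fun=> 0) => m i; rewrite in_nil.
have [t t0 vt] := exists_val C%:Z.
have [j|psi hpsi [l0 hl0]] := @local_seq_compact (fun j => t * u (phi j) 0 i0).
  by rewrite -[0](subrr C%:Z); apply: vgeM => //; rewrite vge_ge // vt.
(* The shift by C makes up for the precision lost on dividing the limit by t. *)
exists (fun m => phi (psi (C + m)%N)) => [m m' h|].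
  by apply: hphi; apply: hpsi; rewrite ltn_add2l.
exists (fun i => if i == i0 then l0 / t else l i) => m i.
have [->|hi] := eqVneq i i0 => his.
  apply: (@vgeM_inv _ _ vP C%:Z _ t) => //; rewrite mulrBr mulrCA divff // mulr1.
  by have -> : C%:Z + m%:Z = (C + m)%N%:Z by []; exact: hl0.
rewrite inE (negPf hi) /= in his.
apply: vge_le (hl (psi (C + m)%N) i his).
by have := homo_ltn_ge (C + m)%N hpsi; lia.
Qed.

(** The determinant is a polynomial with integer coefficients in the entries, so congruences between
    integral matrices pass to it. *)
Lemma vge_det_congr n (j : int) (A B : 'M[k]_n) : (0 <= j)%R ->
  (forall a b, vge v 0 (A a b)) -> (forall a b, vge v 0 (B a b)) ->
  (forall a b, vge v j (A a b - B a b)) -> vge v j (\det A - \det B).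
Proof.
move=> j0 hA hB h; rewrite /determinant -sumrB; apply: vge_sum => // s _.
rewrite -mulrBr; apply: vgeM0l => //; first by apply: vgeX => //; rewrite vgeN ?vge1.
suff [_ _] : [/\ vge v 0 (\prod_i A i (s i)), vge v 0 (\prod_i B i (s i)) &
   vge v j (\prod_i A i (s i) - \prod_i B i (s i))] by [].
elim/big_ind2: _ => //; first by rewrite subrr vge1 // vge0.
move=> x y x' y' [h1 h2 h3] [h4 h5 h6].
by split; [exact: vgeM0l|exact: vgeM0l|exact: vgeMB].
Qed.

End LocalField.

(** * The right regular representation *)

Section MulMatrix.
Variables (k : fieldType) (R : falgType k).
Implicit Types x y z : R.
Notation n := (dim R).

Definition vbase (i : 'I_n) : R := r2v (delta_mx 0 i).

Lemma vbase_sum x : x = \sum_i v2r x 0 i *: vbase i.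
Proof.
apply: (can_inj (@v2rK _ R)); rewrite linear_sum [LHS]row_sum_delta.
by apply: eq_bigr => i _; rewrite linearZ /= r2vK.
Qed.

(** On row vectors, right multiplications compose in the order of the product, so this map is
    multiplicative and not anti-multiplicative. *)
Definition mulmx_of x : 'M[k]_n := \matrix_i v2r (vbase i * x).

Lemma mulmx_ofE x y : v2r y *m mulmx_of x = v2r (y * x).
Proof.
rewrite [y in RHS]vbase_sum mulr_suml linear_sum mulmx_sum_row.
by apply: eq_bigr => i _; rewrite -scalerAl linearZ rowK.
Qed.

Lemma eq_mulmx_row (A B : 'M[k]_n) : (forall x, v2r x *m A = v2r x *m B) -> A = B.
Proof.
move=> h; apply/row_matrixP => i; have := h (vbase i).
by rewrite /vbase r2vK -!rowE.
Qed.

Lemma mulmx_of1 : mulmx_of 1 = 1%:M.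
Proof. by apply: eq_mulmx_row => x; rewrite mulmx_ofE mulr1 mulmx1. Qed.

Lemma mulmx_ofM x y : mulmx_of (x * y) = mulmx_of x *m mulmx_of y.
Proof. by apply: eq_mulmx_row => z; rewrite mulmxA !mulmx_ofE mulrA. Qed.

Lemma mulmx_ofD x y : mulmx_of (x + y) = mulmx_of x + mulmx_of y.
Proof. by apply: eq_mulmx_row => z; rewrite mulmxDr !mulmx_ofE mulrDr linearD. Qed.

Lemma mulmx_ofZ c x : mulmx_of (c *: x) = c *: mulmx_of x.
Proof. by apply: eq_mulmx_row => z; rewrite -scalemxAr !mulmx_ofE -scalerAr linearZ. Qed.

Lemma mulmx_of_sum x : mulmx_of x = \sum_i v2r x 0 i *: mulmx_of (vbase i).
Proof.
rewrite [x in LHS]vbase_sum; elim/big_ind2: _ => [|a A b B <- <-|i _].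
- by rewrite -[0 in LHS](scale0r 0) mulmx_ofZ scale0r.
- exact: mulmx_ofD.
- exact: mulmx_ofZ.
Qed.

Lemma dim_falg_gt0 : (0 < n)%N.
Proof.
rewrite -dimvf lt0n dimv_eq0; apply: contraTneq (memvf (1 : R)) => ->.
by rewrite memv0 oner_neq0.
Qed.

Lemma det_mulmx_of_unit x : x \is a GRing.unit -> \det (mulmx_of x) != 0.
Proof.
move=> hx; apply/eqP => h0; have := congr1 determinant (mulmx_ofM x x^-1).
by rewrite divrr // mulmx_of1 det1 det_mulmx h0 mul0r => /eqP; rewrite oner_eq0.
Qed.

End MulMatrix.

(** * The valuation of a finite-dimensional division algebra *)

Section DivisionAlgebra.
Variables (k : fieldType) (v : k -> int).
Hypothesis Hk : nonarch_local_field_odd v.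
Variable (R : falgType k).
Hypothesis Rdiv : forall x : R, x != 0 -> x \is a GRing.unit.
Implicit Types x y z : R.
Notation n := (dim R).
Let vP := local_valuative Hk.

(** The determinant is the algebra norm. The valuation is left unnormalised: on k it is [dim R]
    times v. *)
Definition nval x : int := v (\det (mulmx_of x)).
Notation w := nval.

Lemma div_mulf_neq0 x y : x != 0 -> y != 0 -> x * y != 0.
Proof.
move=> hx hy; have : x * y \is a GRing.unit by rewrite unitrMl ?Rdiv.
by apply: contraTneq => ->; rewrite unitr0.
Qed.

Lemma nvalM x y : x != 0 -> y != 0 -> w (x * y) = w x + w y.
Proof.
by move=> hx hy; rewrite /w mulmx_ofM det_mulmx (wM vP) // det_mulmx_of_unit ?Rdiv.
Qed.

Lemma nvalZ (c : k) x : c != 0 -> x != 0 -> w (c *: x) = n%:Z * v c + w x.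
Proof.
move=> hc hx; rewrite /w mulmx_ofZ detZ (wM vP) ?expf_neq0 ?det_mulmx_of_unit ?Rdiv //.
by have [_ ->] := wX vP n hc; rewrite -mulr_natl natz.
Qed.

Lemma nval1 : w 1 = 0.
Proof. by rewrite /w mulmx_of1 det1 (w1 vP). Qed.

Lemma nvalX x m : x != 0 -> x ^+ m != 0 /\ w (x ^+ m) = m%:Z * w x.
Proof.
move=> hx; elim: m => [|m [h1 h2]].
  by rewrite expr0 nval1 oner_neq0 mul0r.
by rewrite exprS div_mulf_neq0 // nvalM // h2; split => //; lia.
Qed.

(** The filtration of the sup norm in coordinates. [cge_nval] and [nval_cge] show that it agrees
    with that of [nval] up to bounded shifts, as norms on a finite-dimensional space should. *)
Definition cge (j : int) x : bool := [forall i, vge v j (v2r x 0 i)].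

Lemma cgeP j x : reflect (forall i, vge v j (v2r x 0 i)) (cge j x).
Proof. exact: forallP. Qed.

Lemma cgeD j x y : cge j x -> cge j y -> cge j (x + y).
Proof.
by move=> /cgeP h1 /cgeP h2; apply/cgeP => i; rewrite linearD mxE (vgeD vP).
Qed.

Lemma cgeZ i j c x : vge v i c -> cge j x -> cge (i + j) (c *: x).
Proof. by move=> h1 /cgeP h2; apply/cgeP => l; rewrite linearZ mxE (vgeM vP). Qed.

Lemma vge_finite_bound (T : finType) (F : T -> k) : exists C : nat, forall t, vge v (- C%:Z) (F t).
Proof.
exists (\max_t absz (v (F t))) => t; rewrite /vge; apply/orP; right.
by have := @leq_bigmax _ (fun t => absz (v (F t))) t; lia.
Qed.

(** If -C bounds the structure constants from below, a scalar of value C - j makes the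
    multiplication matrix integral, hence also its determinant. *)
Lemma cge_nval : exists C : nat, forall (j : int) x, cge j x -> vge w (n%:Z * j - C%:Z) x.
Proof.
have [C hC] := @vge_finite_bound ('I_n * 'I_n * 'I_n)%type
   (fun p => mulmx_of (vbase p.1.1) p.1.2 p.2).
exists (n * C)%N => j x /cgeP hx.
have [x0|x0] := eqVneq x 0; first by rewrite x0 vge0.
rewrite vge_ge //.
have [t t0 vt] := exists_val Hk (C%:Z - j).
have tx0 : t *: x != 0 by rewrite scaler_eq0 negb_or t0.
have : 0 <= w (t *: x).
  rewrite -(vge_ge v) ?det_mulmx_of_unit ?Rdiv //.
  (* Integrality is read off from a congruence at level 0 with the zero matrix, whose determinant is
     0 because the dimension is positive. *)
  have -> : \det (mulmx_of (t *: x)) = \det (mulmx_of (t *: x)) - \det (0 : 'M[k]_n).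
    by case: (n) (@dim_falg_gt0 _ R) (mulmx_of _) => // m _ A; rewrite det0 subr0.
  have hA a b : vge v 0 (mulmx_of (t *: x) a b).
    rewrite mulmx_ofZ mulmx_of_sum mxE summxE -(subrr (C%:Z - j)); apply: vgeM => //.
      by rewrite vge_ge // vt.
    apply: vge_sum => // i _; rewrite mxE opprB; apply: vgeM => //.
    exact: (hC (i, a, b)).
  have h0 a b : (0 : 'M[k]_n) a b = 0 by rewrite mxE.
  by apply: vge_det_congr => // a b; rewrite h0 ?subr0 ?vge0.
by rewrite nvalZ // vt; lia.
Qed.

(** A sequence on the unit sphere with values tending to infinity would have a limit point x on the
    sphere. But x is invertible, and near it the value is constant because det(1 + x^-1 y) is
    congruent to 1 for small y. *)
Lemma nval_sphere_bound : exists C : nat, forall x, cge 0 x -> ~~ cge 1 x -> w x <= C%:Z.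
Proof.
apply: NNPP => hno.
have /functional_choice[u hu] : forall j : nat, exists x, [/\ cge 0 x, ~~ cge 1 x & j%:Z < w x].
  move=> j; apply: NNPP => h; apply: hno; exists j => x h1 h2.
  by rewrite leNgt; apply/negP => h3; apply: h; exists x.
have [|phi hphi [l hl]] := @local_seq_compact_row _ _ Hk n (fun j => v2r (u j)) 0.
  by move=> j i; have [/cgeP h _ _] := hu j; exact: h.
pose x := r2v l.
have hx m : cge m%:Z (u (phi m) - x).
  by apply/cgeP => i; rewrite linearB /= mxE mxE /x r2vK; exact: hl.
have x0 : x != 0.
  apply/eqP => x0; have := hx 1; rewrite x0 subr0; apply/negP.
  by have [] := hu (phi 1).
have [C hC] := @vge_finite_bound ('I_n * 'I_n * 'I_n)%type
   (fun p => mulmx_of (x^-1 * vbase p.1.1) p.1.2 p.2).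
have hm m : (C < m)%N -> w (u (phi m)) = w x.
  move=> Cm; pose y := u (phi m) - x.
  have -> : u (phi m) = x * (1 + x^-1 * y).
    by rewrite mulrDr mulr1 mulVKr ?Rdiv // addrC subrK.
  suff [h1 h2] : \det (mulmx_of (1 + x^-1 * y)) != 0 /\ v (\det (mulmx_of (1 + x^-1 * y))) = v 1.
    rewrite /w mulmx_ofM det_mulmx (wM vP (det_mulmx_of_unit (Rdiv x0)) h1).
    by rewrite h2 (w1 vP) addr0.
  apply: (w_close vP (oner_neq0 k)); rewrite (w1 vP) add0r.
  have hB a b : vge v 1 (mulmx_of (x^-1 * y) a b).
    rewrite [y]vbase_sum mulr_sumr.
    have -> : mulmx_of (\sum_i x^-1 * (v2r y 0 i *: vbase i)) =
              \sum_i v2r y 0 i *: mulmx_of (x^-1 * vbase i).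
      elim/big_ind2: _ => [|a' A b' B <- <-|i _].
      - by rewrite -[0 in LHS](scale0r 0) mulmx_ofZ scale0r.
      - exact: mulmx_ofD.
      - by rewrite -scalerAr mulmx_ofZ.
    rewrite summxE; apply: vge_sum => // i _; rewrite mxE.
    apply: (@vge_le _ _ _ (m%:Z + - C%:Z)); first by lia.
    apply: vgeM => //; last exact: (hC (i, a, b)).
    exact: (cgeP _ _ (hx m)).
  rewrite -[1 in X in X - _](det1 k n) mulmx_ofD mulmx_of1; apply: vge_det_congr => // a b.
  - by rewrite mxE (vge_nat vP).
  - by rewrite mxE (vgeD vP) ?(vge_le _ (hB a b)) // mxE (vge_nat vP).
  - by rewrite [X in _ - X]mxE opprD addrA subrr add0r (vgeN vP).
(* This m is beyond C, so the value at [phi m] is that of x; it is also larger than |w x|, while the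
   m-th chosen values exceed m. *)
pose m := (C + absz (w x)).+1.
have [_ _] := hu (phi m); rewrite hm; last by rewrite /m; lia.
have := homo_ltn_ge m hphi; rewrite /m; lia.
Qed.

(** Scaling by the inverse of the smallest coordinate moves x to the unit sphere, where
    [nval_sphere_bound] applies. *)
Lemma nval_cge : exists C : nat, forall (j : int) x, vge w (n%:Z * j + C%:Z) x -> cge j x.
Proof.
have [C hC] := nval_sphere_bound; exists C => j x.
have [->|x0] := eqVneq x 0.
  by move=> _; apply/cgeP => i; rewrite linear0 mxE vge0.
rewrite vge_ge // => hw.
have [i0 hi0] : exists i, v2r x 0 i != 0.
  apply/existsP; apply: contraNT x0; rewrite negb_exists => /forallP h.
  rewrite -(inj_eq (can_inj (@v2rK _ R))) linear0; apply/eqP/rowP => i; rewrite mxE.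
  exact/eqP/negPn/h.
case: (@arg_minP _ _ _ i0 (fun i => v2r x 0 i != 0) (fun i => v (v2r x 0 i)) hi0).
move=> i hi hmin; set m := v (v2r x 0 i) in hmin.
have [t t0 vt] := exists_val Hk (- m).
have h : w (t *: x) <= C%:Z.
  apply: hC.
    apply/cgeP => a; rewrite linearZ mxE -(subrr m) addrC; apply: vgeM => //.
      by rewrite vge_ge // vt.
    by rewrite /vge; have [//|/hmin] := eqVneq (v2r x 0 a) 0.
  by apply/negP => /cgeP/(_ i); rewrite linearZ mxE vge_ge ?mulf_neq0 // (wM vP) // vt addNr.
rewrite nvalZ // vt in h.
have jm : j <= m.
  have := dim_falg_gt0 R; nia.
apply/cgeP => a; rewrite /vge; have [//|/hmin h'] := eqVneq (v2r x 0 a) 0.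
exact: le_trans jm h'.
Qed.

(** It suffices to treat 1 + x with x of value at least 0. The powers of x have bounded coordinates,
    hence by the binomial formula so do those of 1 + x; a negative value of 1 + x would make the
    values of its powers unbounded below. *)
Lemma nval_valuative : valuative w.
Proof.
have [C hC] := nval_cge; have [C' hC'] := cge_nval; have n0 := dim_falg_gt0 R.
split=> [x y hx hy|]; first by rewrite div_mulf_neq0 ?nvalM.
have h1 x : vge w 0 x -> vge w 0 (1 + x).
  move=> hx.
  have hX m : cge (- C%:Z) (x ^+ m).
    apply: hC; move: hx; rewrite /vge; have [->|x0] := eqVneq x 0.
      case: m => [|m]; last by rewrite exprS mul0r eqxx.
      by rewrite expr0 nval1 => _; apply/orP; right; nia.
    by have [_ ->] := nvalX m x0 => /= h; apply/orP; right; nia.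
  have hX1 m : cge (- C%:Z) ((1 + x) ^+ m).
    rewrite addrC exprDn_comm; last exact/commr1.
    elim/big_ind: _ => [|a b|i _]; last 1 first.
    - rewrite expr1n mulr1 -scaler_nat -[- C%:Z]add0r; apply: cgeZ => //.
      exact: vge_nat.
    - by apply/cgeP => i; rewrite linear0 mxE vge0.
    - exact: cgeD.
  rewrite /vge; have [//|x0 /=] := eqVneq (1 + x) 0.
  (* All powers have value at least -(nC + C'); an exponent one larger than nC + C' therefore
     excludes a value of -1 or less. *)
  have := hC' _ _ (hX1 (n * C + C').+1); have [h2 h3] := nvalX (n * C + C').+1 x0.
  by rewrite vge_ge // h3; nia.
have hD x y j : x != 0 -> y != 0 -> w x <= w y -> j <= w x -> vge w j (x + y).
  move=> hx hy hxy hj.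
  have hx' : x^-1 != 0 by rewrite invr_eq0.
  have -> : x + y = x * (1 + x^-1 * y) by rewrite mulrDr mulr1 mulVKr ?Rdiv.
  have : vge w 0 (1 + x^-1 * y).
    apply: h1; rewrite vge_ge ?div_mulf_neq0 //.
    have := nval1; rewrite -(divrr (Rdiv hx)) !nvalM //; lia.
  rewrite /vge; have [->|h0 /= h] := eqVneq (1 + x^-1 * y) 0.
    by rewrite mulr0 eqxx.
  by rewrite nvalM //; apply/orP; right; lia.
move=> j x y; have [->|x0] := eqVneq x 0; first by rewrite add0r.
have [->|y0] := eqVneq y 0; first by rewrite addr0.
rewrite [vge w j x]vge_ge // [vge w j y]vge_ge // => hx hy.
have [h|h] := leP (w x) (w y); first exact: hD.
by rewrite addrC; apply: hD => //; exact: ltW.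
Qed.
Let wP := nval_valuative.

Lemma nval_alg (c : k) : c != 0 -> w c%:A = n%:Z * v c.
Proof. by move=> hc; rewrite nvalZ ?oner_neq0 // nval1 addr0. Qed.

Lemma nval_seq_compact (u : nat -> R) : (forall j, vge w 0 (u j)) ->
  exists2 phi : nat -> nat, {homo phi : m n / (m < n)%N} &
  exists l, forall m : nat, vge w m%:Z (u (phi m) - l).
Proof.
move=> hu; have [C hC] := nval_cge; have [C' hC'] := cge_nval; have n0 := dim_falg_gt0 R.
have [j i|phi hphi [l hl]] := @local_seq_compact_row _ _ Hk n (fun j => v2r (u j)) C.
  apply: (cgeP _ _ (hC (- C%:Z) (u j) _)); apply: vge_le (hu j); nia.
exists (fun m => phi (m + C')%N) => [i j hij|]; first by apply: hphi; rewrite ltn_add2r.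
exists (r2v l) => m.
have : cge (m + C')%N%:Z (u (phi (m + C')%N) - r2v l).
  by apply/cgeP => i; rewrite linearB /= mxE mxE r2vK; exact: hl.
by move/hC'; apply: vge_le; nia.
Qed.

Lemma nval_functional_bound (f : R -> k) :
  (forall c x y, f (c *: x + y) = c * f x + f y) ->
  exists C : nat, forall (j : int) x, vge w (n%:Z * j + C%:Z) x -> vge v j (f x).
Proof.
move=> hf; have [C hC] := nval_cge.
have [C' hC'] := @vge_finite_bound _ (fun i => f (vbase i)).
have f0 : f 0 = 0.
  by have := hf (-1) 0 0; rewrite scaler0 addr0 mulN1r addNr.
have fE x : f x = \sum_i v2r x 0 i * f (vbase i).
  rewrite [x in LHS]vbase_sum; elim/big_ind2: _ => // [a A b B <- <-|i _].
    by have := hf 1 A B; rewrite scale1r mul1r.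
  by rewrite -[_ *: _]addr0 hf f0 addr0.
exists (C + n * C')%N => j x hx.
have {}hx : cge (j + C'%:Z) x by apply: hC; apply: vge_le hx; nia.
rewrite fE; apply: vge_sum => // i _.
have -> : j = (j + C'%:Z) + - C'%:Z by lia.
by apply: vgeM => //; exact: (cgeP _ _ hx).
Qed.

(** If x had negative value, the leading term of an integral equation would have strictly smaller
    value than all the others. *)
Lemma int_ring_nval x : int_ring v x -> vge w 0 x.
Proof.
move=> [p [pm hp /rootP px]]; rewrite /vge; have [//|x0 /=] := eqVneq x 0.
have n0 := dim_falg_gt0 R.
rewrite leNgt; apply/negP => wx.
have sp : size (map_poly (in_alg R) p) = size p by rewrite size_map_poly.
have hs : size p = (size p).-1.+1.
  by rewrite prednK // lt0n size_poly_eq0 monic_neq0.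
move: px; rewrite horner_coef sp hs big_ord_recr /= coef_map /=.
have -> : p`_(size p).-1 = 1 by apply/eqP.
rewrite scale1r mul1r; set m := (size p).-1 => /eqP; rewrite addr_eq0 => /eqP h.
have [xm wxm] := nvalX m x0.
have : vge w (m%:Z * w x + 1) (- x ^+ m).
  rewrite -h; apply: vge_sum => // i _; rewrite coef_map /=.
  have [-> |pi0] := eqVneq p`_i 0; first by rewrite scale0r mul0r vge0.
  have [xi wxi] := nvalX i x0.
  have := hp i => /val_ringP; rewrite vge_ge // => hpi.
  rewrite -scalerAl mul1r vge_ge ?scaler_eq0 ?negb_or ?pi0 // nvalZ // wxi.
  have h1 : 0 <= (dim R)%:Z * v p`_i by rewrite mulr_ge0.
  have h2 : (i%:Z - m%:Z) * w x >= 1 by have := ltn_ord i; rewrite -/m; nia.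
  apply: (@le_trans _ _ (i%:Z * w x)); last by rewrite lerDr.
  by rewrite addrC -lerBrDr -mulrBl.
by rewrite (vgeN wP) vge_ge // wxm; lia.
Qed.

(** By compactness two high powers x^a and x^b are close. Their difference is then a combination of
    the basis 1, x, ..., x^(m-1) of k[x] with coefficients in o_k, which yields a monic integral
    equation of degree a. *)
Lemma nval_int_ring x : vge w 0 x -> int_ring v x.
Proof.
move=> hx.
(* The powers are listed downwards, x^(m-1) first, which is why m - 1 - i appears as exponent
   below. *)
pose X := fix X m := if m is m'.+1 then x ^+ m' :: X m' else [::].
have sX m : size (X m) = m by elim: m => //= m ->.
have nX m i : (i < m)%N -> (X m)`_i = x ^+ (m.-1 - i).
  elim: m i => // m IH [|i] /=; first by rewrite subn0.
  by rewrite ltnS => h; rewrite IH //; congr (_ ^+ _); lia.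
have ex : exists m, x ^+ m \in <<X m>>%VS.
  apply: NNPP => hno.
  have fX m : free (X m).
    elim: m => [|m IH] /=; first exact: nil_free.
    by rewrite free_cons IH andbT; apply/negP => h; apply: hno; exists m.
  have := dimvS (subvf <<X (dim R).+1>>); rewrite dimvf.
  by have := fX (dim R).+1; rewrite /free => /eqP->; rewrite sX ltnn.
case: (ex_minnP ex) => m hm hmin.
have fX : free (X m).
  have : forall i, (i <= m)%N -> free (X i).
    elim=> [|i IH] hi /=; first exact: nil_free.
    rewrite free_cons IH ?(ltnW hi) // andbT; apply/negP => /hmin; lia.
  by apply.
have hpow j : x ^+ j \in <<X m>>%VS.
  have step y : y \in <<X m>>%VS -> y * x \in <<X m>>%VS.
    move=> hy; rewrite (coord_span (X := in_tuple (X m)) hy) mulr_suml.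
    apply: rpred_sum => i _; rewrite -scalerAl; apply: rpredZ.
    have him : (i < m)%N by have := ltn_ord i; rewrite {2}sX.
    rewrite /= nX // -exprSr.
    case: (nat_of_ord i) him => [|i'] him.
      by rewrite subn0 prednK //; lia.
    have -> : (m.-1 - i'.+1).+1 = (m.-1 - i')%N by lia.
    rewrite -(nX m i'); last by lia.
    by apply/memv_span/mem_nth; rewrite sX; lia.
  have [jm|mj] := ltnP j m.
    have -> : x ^+ j = (X m)`_(m.-1 - j) by rewrite nX; [congr (_ ^+ _)|]; lia.
    by apply/memv_span/mem_nth; rewrite sX; lia.
  rewrite -(subnK mj); elim: (j - m)%N => // i IH.
  by rewrite addSn exprSr step.
have [C hC] : exists C : nat, forall i, forall y, vge w C%:Z y -> vge v 0 (coord (in_tuple (X m)) i y).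
  have /functional_choice[f hf] : forall i : 'I_(size (X m)), exists C : nat,
      forall y, vge w C%:Z y -> vge v 0 (coord (in_tuple (X m)) i y).
    move=> i; have [c a b|C hC] := @nval_functional_bound (coord (in_tuple (X m)) i).
      by rewrite linearD linearZ.
    by exists C => y hy; apply: hC; rewrite mulr0 add0r.
  exists (\max_i f i) => i y hy; apply: (hf i); apply: vge_le hy.
  by have := @leq_bigmax _ f i; lia.
have [phi hphi [l hl]] := nval_seq_compact (fun j => vgeX wP j hx).
(* Being at least C, c makes the coordinates of the difference integral; being at least m, it makes
   a exceed the degrees of all basis powers. *)
pose c := (C + m)%N; pose a := phi c.+1; pose b := phi c.
have ab : (b < a)%N by apply: hphi.
have ca : (c < a)%N by apply: homo_ltn_ge.
pose y := x ^+ a - x ^+ b.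
have hy : vge w C%:Z y.
  apply: (@vge_trans _ _ wP _ _ l); last rewrite (vgeBC wP).
    by apply: vge_le (hl c.+1); rewrite /c; lia.
  by apply: vge_le (hl c); rewrite /c; lia.
have yE : y = \sum_i coord (in_tuple (X m)) i y *: (X m)`_i.
  by rewrite -(@coord_span _ _ _ (in_tuple (X m))) //= rpredB.
pose r : {poly k} := - 'X^b - \sum_(i < size (X m)) coord (in_tuple (X m)) i y *: 'X^(m.-1 - i).
exists ('X^a + r).
have sr : (size r < size ('X^a : {poly k}))%N.
  rewrite size_polyXn ltnS; apply: leq_trans (size_polyD _ _) _.
  rewrite !size_polyN geq_max size_polyXn ab /=.
  apply: leq_trans (size_sum _ _ _) _; apply/bigmax_leqP => i _.
  apply: leq_trans (size_scale_leq _ _) _; rewrite size_polyXn.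
  by have := ltn_ord i; rewrite {2}sX /c in ca *; lia.
split.
- by rewrite monicE lead_coefDl // lead_coefXn.
- move=> i; apply/val_ringP; rewrite !coefE.
  have hb : vge v 0 (i == b)%:R by exact: vge_nat.
  apply: (vgeD vP); first exact: vge_nat.
  apply: (vgeB vP); first by rewrite (vgeN vP).
  apply: vge_sum => // j _.
  exact: hC.
- apply/rootP; rewrite !rmorphD !rmorphN /= !map_polyXn rmorph_sum /=.
  rewrite !(hornerD, hornerN, hornerXn) horner_sum addrA -/y {1}yE -sumrB big1 // => i _.
  rewrite map_polyZ map_polyXn /= hornerZ hornerXn nX ?subrr //.
    by rewrite mulr_algl subrr.
  by have := ltn_ord i; rewrite {2}sX.
Qed.

Lemma int_ringP x : int_ring v x <-> vge w 0 x.
Proof. by split; [exact: int_ring_nval|exact: nval_int_ring]. Qed.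

Lemma nvalV x : x != 0 -> w x^-1 = - w x.
Proof.
move=> x0; have := nval1; rewrite -(divrr (Rdiv x0)) nvalM ?invr_eq0 //; lia.
Qed.

Lemma int_idealP x : int_ideal v x <-> vge w 1 x.
Proof.
split=> [[/int_ringP h h']|h].
  move: h; rewrite /vge; have [//|x0 /= h] := eqVneq x 0.
  have [h1|h1] := leP 1 (w x); first by [].
  case: h'; split; first exact: Rdiv.
  by apply/int_ringP; rewrite vge_ge ?invr_eq0 // nvalV //; lia.
split; first by apply/int_ringP; apply: vge_le h.
move=> [xu /int_ringP].
have x0 : x != 0 by apply: contraTneq xu => ->; rewrite unitr0.
by move: h; rewrite !vge_ge ?invr_eq0 // nvalV //; lia.
Qed.

Lemma vge_alg (c : k) : vge w 1 (c%:A : R) = vge v 1 c.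
Proof.
have [->|c0] := eqVneq c 0; first by rewrite scale0r !vge0.
rewrite !vge_ge ?scaler_eq0 ?negb_or ?c0 ?oner_neq0 // nval_alg //.
by have := dim_falg_gt0 R => n0; apply/idP/idP; nia.
Qed.

End DivisionAlgebra.

(** * The residue field as a finite field *)

Section ResidueField.
Variables (R : nzRingType) (w : R -> int).
Hypothesis wP : valuative w.
Hypothesis wV : forall x : R, x != 0 -> w x = 0 ->
  exists2 y, vge w 0 y & x * y = 1 /\ y * x = 1.
Variable s : seq R.
Hypothesis sO : forall y, y \in s -> vge w 0 y.
Hypothesis sP : forall x, vge w 0 x -> exists2 y, y \in s & vge w 1 (x - y).
Implicit Types x y z : R.

(** The first congruent element of the list depends only on the residue class, so it serves as a
    canonical form in place of a quotient. *)
Definition residue_repr x := nth 0 s (find (fun y => vge w 1 (x - y)) s).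

Lemma residue_rep_in x : vge w 0 x -> residue_repr x \in s /\ vge w 1 (x - residue_repr x).
Proof.
move=> /sP[y ys hy].
have h : has (fun y => vge w 1 (x - y)) s by apply/hasP; exists y.
by split; [rewrite mem_nth -?has_find|exact: (nth_find 0 h)].
Qed.

Lemma residue_rep_eq x y : vge w 1 (x - y) -> residue_repr x = residue_repr y.
Proof.
move=> h; rewrite /residue_repr; congr nth; apply: eq_find => z.
apply/idP/idP => h'; apply: (vge_trans wP _ h'); by rewrite // (vgeBC wP).
Qed.

(** The list [s] may contain congruent elements; only canonical representatives are kept. *)
Definition residue_type : finType := seq_sub (undup (map residue_repr s)).

Lemma residue_repr_subproof x : residue_repr (if vge w 0 x then x else 0) \in undup (map residue_repr s).
Proof.
rewrite mem_undup; set y := if _ then _ else _.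
have hy : vge w 0 y by rewrite /y; case: ifP => // _; exact: vge0.
have [h1 h2] := residue_rep_in hy; apply/mapP; exists (residue_repr y) => //; exact: residue_rep_eq.
Qed.

(** The map is total: elements that are not integral go to the class of 0. *)
Definition residue x : residue_type := SeqSub (residue_repr_subproof x).

Lemma residue_val_integral (a : residue_type) : vge w 0 (ssval a).
Proof.
by case: a => a /=; rewrite mem_undup => /mapP[y /sO/residue_rep_in[/sO h _] ->].
Qed.

#[local] Hint Resolve residue_val_integral : core.

Lemma residueK x : vge w 0 x -> vge w 1 (x - ssval (residue x)).
Proof. by move=> hx; rewrite /= hx; case: (residue_rep_in hx). Qed.

Lemma eq_residue x y : vge w 0 x -> vge w 1 (x - y) -> residue x = residue y.
Proof.
move=> hx h; apply: val_inj => /=.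
by rewrite hx (vge_close wP (vge_le _ h) hx) //; exact: residue_rep_eq.
Qed.

Lemma residue_valK (a : residue_type) : residue (ssval a) = a.
Proof.
apply: val_inj => /=; rewrite residue_val_integral; case: a => a /=.
rewrite mem_undup => /mapP[y /sO hy ->].
by apply/esym/residue_rep_eq; case: (residue_rep_in hy).
Qed.

Lemma eq_residue_congr x y : vge w 0 x -> vge w 0 y -> residue x = residue y -> vge w 1 (x - y).
Proof.
move=> hx hy h; apply: (vge_trans wP (residueK hx)); rewrite h (vgeBC wP); exact: residueK.
Qed.

Definition residue_add (a b : residue_type) : residue_type := residue (ssval a + ssval b).
Definition residue_mul (a b : residue_type) : residue_type := residue (ssval a * ssval b).
Definition residue_opp (a : residue_type) : residue_type := residue (- ssval a).

Lemma residueD x y : vge w 0 x -> vge w 0 y -> residue_add (residue x) (residue y) = residue (x + y).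
Proof.
move=> hx hy; apply/esym/eq_residue; first exact: vgeD.
by rewrite opprD addrACA (vgeD wP) // residueK.
Qed.

Lemma residueM x y : vge w 0 x -> vge w 0 y -> residue_mul (residue x) (residue y) = residue (x * y).
Proof.
move=> hx hy; apply/esym/eq_residue; first exact: vgeM0l.
by apply: vgeMB => //; exact: residueK.
Qed.

Lemma residueN x : vge w 0 x -> residue_opp (residue x) = residue (- x).
Proof.
move=> hx; apply/esym/eq_residue; first by rewrite (vgeN wP).
by rewrite -opprD (vgeN wP) residueK.
Qed.

Let O0 : vge w 0 0 := vge0 w 0.
Let O1 := vge1 wP.
Let OD := @vgeD _ _ wP 0.
Let OM := @vgeM0l _ _ wP 0.
Let ON x : vge w 0 x -> vge w 0 (- x). Proof. by rewrite (vgeN wP). Qed.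

Lemma residue_addA : associative residue_add.
Proof. by move=> a b c; rewrite -[a]residue_valK -[b]residue_valK -[c]residue_valK !residueD ?OD // addrA. Qed.
Lemma residue_addC : commutative residue_add.
Proof. by move=> a b; rewrite /residue_add addrC. Qed.
Lemma residue_add0 : left_id (residue 0) residue_add.
Proof. by move=> a; rewrite -[a]residue_valK residueD // add0r. Qed.
Lemma residue_addN : left_inverse (residue 0) residue_opp residue_add.
Proof. by move=> a; rewrite -[a]residue_valK residueN // residueD ?ON // addNr. Qed.
Lemma residue_mulA : associative residue_mul.
Proof. by move=> a b c; rewrite -[a]residue_valK -[b]residue_valK -[c]residue_valK !residueM ?OM // mulrA. Qed.
Lemma residue_mul1 : left_id (residue 1) residue_mul.
Proof. by move=> a; rewrite -[a]residue_valK residueM // mul1r. Qed.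
Lemma residue_mulr1 : right_id (residue 1) residue_mul.
Proof. by move=> a; rewrite -[a]residue_valK residueM // mulr1. Qed.
Lemma residue_mulDl : left_distributive residue_mul residue_add.
Proof.
by move=> a b c; rewrite -[a]residue_valK -[b]residue_valK -[c]residue_valK !(residueM, residueD) ?OM ?OD // mulrDl.
Qed.
Lemma residue_mulDr : right_distributive residue_mul residue_add.
Proof.
by move=> a b c; rewrite -[a]residue_valK -[b]residue_valK -[c]residue_valK !(residueM, residueD) ?OM ?OD // mulrDr.
Qed.
Lemma residue_1_neq0 : residue 1 != residue 0.
Proof.
apply/eqP => /(eq_residue_congr O1 O0); rewrite subr0 (vge_ge _ _ (oner_neq0 R)) (w1 wP); by [].
Qed.

Lemma residue_val_unit (a : residue_type) : a != residue 0 -> ssval a != 0 /\ w (ssval a) = 0.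
Proof.
move=> h; have h' : ~~ vge w 1 (ssval a).
  by apply: contraNN h => h; rewrite -[a]residue_valK; apply/eqP/eq_residue => //; rewrite subr0.
have h0 : ssval a != 0 by apply: contraNneq h' => ->; exact: vge0.
by split=> //; have := residue_val_integral a; move: h'; rewrite !vge_ge //; lia.
Qed.

Lemma residue_exV (a : residue_type) : exists b : residue_type, a != residue 0 -> residue_mul a b = residue 1 /\ residue_mul b a = residue 1.
Proof.
have [->|h] := eqVneq a (residue 0); first by exists a.
have [h1 h2] := residue_val_unit h; have [y hy [e1 e2]] := wV h1 h2.
by exists (residue y) => _; rewrite -[a]residue_valK !residueM // e1 e2.
Qed.

Definition residue_inv (a : residue_type) : residue_type :=
  if a == residue 0 then a else odflt a [pick b | (residue_mul a b == residue 1) && (residue_mul b a == residue 1)].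

Lemma residue_invP (a : residue_type) : a != residue 0 -> residue_mul a (residue_inv a) = residue 1 /\ residue_mul (residue_inv a) a = residue 1.
Proof.
move=> h; rewrite /residue_inv (negPf h); case: pickP => [b /andP[/eqP e1 /eqP e2] //|h0].
by have [b /(_ h) [e1 e2]] := residue_exV a; have := h0 b; rewrite e1 e2 !eqxx.
Qed.

Lemma residue_mulr0 (a : residue_type) : residue_mul a (residue 0) = residue 0.
Proof. by rewrite -[a]residue_valK residueM // mulr0. Qed.

Definition residue_zmod : zmodType := HB.pack residue_type (GRing.isZmodule.Build residue_type residue_addA residue_addC residue_add0 residue_addN).
Definition residue_ring : nzRingType := HB.pack residue_zmod
  (GRing.Zmodule_isNzRing.Build residue_zmod residue_mulA residue_mul1 residue_mulr1 residue_mulDl residue_mulDr residue_1_neq0).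

Definition residue_invR : residue_ring -> residue_ring := residue_inv.

Lemma residue_mulVx : {in [pred x : residue_ring | x != 0], left_inverse (1 : residue_ring) residue_invR *%R}.
Proof. by move=> a; rewrite inE => /residue_invP[]. Qed.
Lemma residue_mulxV : {in [pred x : residue_ring | x != 0], right_inverse (1 : residue_ring) residue_invR *%R}.
Proof. by move=> a; rewrite inE => /residue_invP[]. Qed.
Lemma residue_unitP (x y : residue_ring) : y * x = 1 /\ x * y = 1 -> [pred x : residue_ring | x != 0] x.
Proof.
move=> [h _]; rewrite inE; apply/eqP => x0; move: h; rewrite x0 mulr0 => /esym/eqP.
by rewrite oner_eq0.
Qed.
Lemma residue_inv_out : {in [predC [pred x : residue_ring | x != 0]], residue_invR =1 id}.
Proof. by move=> a; rewrite !inE negbK => /eqP ->; rewrite /residue_invR /residue_inv eqxx. Qed.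

Definition residue_unitring : finUnitRingType := HB.pack residue_ring residue_type
  (GRing.NzRing_hasMulInverse.Build residue_ring residue_mulVx residue_mulxV residue_unitP residue_inv_out).

Lemma residue_domain : GRing.integral_domain_axiom residue_unitring.
Proof.
move=> a b h; have [//|ha /=] := eqVneq a 0.
apply/eqP; have [_ e] := residue_invP ha; rewrite -[b](residue_mul1 b) -e -residue_mulA.
by rewrite [residue_mul a b]h residue_mulr0.
Qed.

Definition residue_fin_field : finFieldType := FinDomainFieldType residue_domain.

Lemma residue_field : exists (F : finFieldType) (f : R -> F),
  [/\ forall x y, vge w 0 x -> vge w 0 y -> f (x + y) = f x + f y,
      forall x y, vge w 0 x -> vge w 0 y -> f (x * y) = f x * f y,
      f 1 = 1,
      forall x y, vge w 0 x -> vge w 0 y -> f x = f y <-> vge w 1 (x - y)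
    & forall a, exists2 x, vge w 0 x & f x = a].
Proof.
exists residue_fin_field, residue; split=> [x y hx hy|x y hx hy||x y hx hy|a].
- exact/esym/residueD.
- exact/esym/residueM.
- by [].
- by split; [exact: eq_residue_congr|exact: eq_residue].
- by exists (ssval (a : residue_type)); [exact: residue_val_integral|exact: residue_valK].
Qed.

End ResidueField.

(* Wedderburn's little theorem makes the residue ring a finite field, whose
   multiplicative group is cyclic. *)
Lemma residue_field_generator (R : nzRingType) (w : R -> int) (s : seq R) :
  valuative w ->
  (forall x : R, x != 0 -> w x = 0 -> exists2 y, vge w 0 y & x * y = 1 /\ y * x = 1) ->
  (forall y, y \in s -> vge w 0 y) ->
  (forall x, vge w 0 x -> exists2 y, y \in s & vge w 1 (x - y)) ->
  exists g N, [/\ (0 < N)%N, vge w 0 g, vge w 1 (g ^+ N - 1), vge w 1 (N.+1%:R)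
    & forall x, vge w 0 x -> ~~ vge w 1 x -> exists j : nat, vge w 1 (x - g ^+ j)].
Proof.
move=> wP wV sO sP.
have [F [f [fD fM f1 fP f_surj]]] := residue_field wP wV sO sP.
have O0 := vge0 w 0; have O1 := vge1 wP.
have f0 : f 0 = 0.
  by have := fD 0 0 O0 O0; rewrite addr0 -{1}[f 0]addr0 => /addrI.
have fX x n : vge w 0 x -> f (x ^+ n) = f x ^+ n.
  by move=> hx; elim: n => // n IH; rewrite !exprS -IH fM ?vgeX.
have fn n : f n%:R = n%:R.
  by elim: n => // n IH; rewrite !mulrS -IH -f1 fD ?vge_nat.
have [u hu] := cyclicP (field_unit_group_cyclic [set: {unit F}]%G).
have [g hg fg] := f_surj (FinRing.uval u).
have uX j : FinRing.uval (u ^+ j)%g = FinRing.uval u ^+ j.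
  by elim: j => // j IH; rewrite expgS exprS -IH.
exists g, #|[set: {unit F}]|; split=> //.
- apply/fP => //; first exact: vgeX.
  by rewrite fX // fg f1 -uX (@expg_cardG _ [set: {unit F}]%G) ?inE.
(* N + 1 is the cardinality of the residue field, so it vanishes there. *)
- rewrite -[_%:R]subr0; apply/fP => //; first exact: vge_nat.
  rewrite fn f0 card_finField_unit prednK; last by apply/card_gt0P; exists 0.
  by apply/eqP; rewrite -cardsT -order_dvdn order_dvdG ?inE.
- move=> x hx hx1.
  have x0 : f x != 0.
    by apply: contraNneq hx1; rewrite -f0 => /fP; rewrite subr0; apply.
  have xu : f x \is a GRing.unit by rewrite unitfE.
  have : FinRing.Unit xu \in <[u]>%g by rewrite -hu inE.
  case/cycleP => j hj; exists j; apply/fP => //; first exact: vgeX.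
  by rewrite fX // fg -uX -hj.
Qed.

(** * Uniformizers and Teichmueller representatives *)

Lemma classical_ex_minn (P : nat -> Prop) : (exists m, P m) ->
  exists2 m, P m & forall j, P j -> (m <= j)%N.
Proof.
case=> m; elim/ltn_ind: m => m IH Pm.
have [[j jm Pj]|h] := classic (exists2 j, (j < m)%N & P j); first exact: IH Pj.
by exists m => // j Pj; rewrite leqNgt; apply/negP => jm; apply: h; exists j.
Qed.

Section LocalDivisionAlgebra.
Variables (k : fieldType) (v : k -> int).
Hypothesis Hk : nonarch_local_field_odd v.
Variable (D : falgType k).
Hypothesis Ddiv : forall x : D, x != 0 -> x \is a GRing.unit.
Implicit Types x y z : D.
Notation n := (dim D).
Notation w := (@nval k v D).
Let vP := local_valuative Hk.
Let wP : valuative w := nval_valuative Hk Ddiv.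

Lemma unit_neq0 x : x \is a GRing.unit -> x != 0.
Proof. by apply: contraTneq => ->; rewrite unitr0. Qed.

(** Otherwise there is an infinite sequence of pairwise incongruent integral elements, and two terms
    of a convergent subsequence contradict this. *)
Lemma finite_residue : exists2 s : seq D, (forall y, y \in s -> vge w 0 y) &
  forall x, vge w 0 x -> exists2 y, y \in s & vge w 1 (x - y).
Proof.
apply: NNPP => hno.
have /functional_choice[f hf] : forall s : seq D, exists x, (forall y, y \in s -> vge w 0 y) ->
    vge w 0 x /\ forall y, y \in s -> ~~ vge w 1 (x - y).
  move=> s; apply: NNPP => h1; apply: hno; exists s => [y ys|x hx].
    by apply: NNPP => h2; apply: h1; exists 0 => /(_ y ys).
  apply: NNPP => h2; apply: h1; exists x => _; split=> // y ys.
  by apply/negP => h3; apply: h2; exists y.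
pose X := fix X m := if m is m'.+1 then f (X m') :: X m' else [::].
have XO m : forall y, y \in X m -> vge w 0 y.
  elim: m => //= m IH y; rewrite inE => /orP[/eqP->|/IH//].
  by case: (hf _ IH).
have Xin i j : (i < j)%N -> f (X i) \in X j.
  elim: j => // j IH; rewrite ltnS leq_eqVlt /= inE => /orP[/eqP->|/IH->].
    by rewrite eqxx.
  by rewrite orbT.
have [phi hphi [l hl]] := nval_seq_compact Hk Ddiv (fun j => proj1 (hf _ (XO j))).
have [_ /(_ _ (Xin _ _ (hphi 1%N 2%N isT)))/negP] := hf _ (XO (phi 2)); apply.
apply: (vge_trans wP (vge_le _ (hl 2%N))) => //.
by rewrite (vgeBC wP); exact: hl.
Qed.

Lemma nvalXz x (q : int) : x != 0 -> x ^ q != 0 /\ w (x ^ q) = q * w x.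
Proof.
move=> x0; case: q => m; first exact: (nvalX Hk Ddiv m x0).
have [h1 h2] := nvalX Hk Ddiv m.+1 x0.
by rewrite NegzE -exprnN invr_eq0 h1 (nvalV Hk Ddiv) // h2 mulNr.
Qed.

(** An element of least positive value: Euclidean division of any other value by it leaves a smaller
    value, which must be 0. *)
Lemma exists_uniformizer : exists x0 : D, [/\ x0 != 0, 0 < w x0 &
  forall x, x != 0 -> exists q : int, w x = q * w x0].
Proof.
have [|m [x0 [x00 wx0 m0]] hmin] :=
  @classical_ex_minn (fun m => exists x, [/\ x != 0, w x = m%:Z & (0 < m)%N]).
  have [t t0 vt] := exists_val Hk 1.
  exists n, t%:A; rewrite scaler_eq0 negb_or t0 oner_neq0; split=> //.
    by rewrite (nval_alg Hk Ddiv) // vt mulr1.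
  exact: dim_falg_gt0.
exists x0; split=> // [|x x0']; first by rewrite wx0; lia.
have [h1 h2] := nvalXz (- (w x %/ m%:Z)%Z) x00.
exists (w x %/ m%:Z)%Z; rewrite wx0 {1}(divz_eq (w x) m%:Z).
have h3 := nvalM Hk Ddiv x0' h1.
have e : w (x * x0 ^ (- (w x %/ m%:Z)%Z)) = (w x %% m%:Z)%Z.
  by rewrite h3 h2 wx0 {1}(divz_eq (w x) m%:Z) mulNr addrAC subrr add0r.
have r0 : (0 <= w x %% m%:Z)%Z by rewrite modz_ge0 //; lia.
have rm : (w x %% m%:Z < m%:Z)%Z by rewrite ltz_pmod //; lia.
have [->|rn0] := eqVneq (w x %% m%:Z)%Z 0; first by rewrite addr0.
have /hmin : exists y, [/\ y != 0, w y = (absz (w x %% m%:Z)%Z)%:Z & (0 < absz (w x %% m%:Z)%Z)%N].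
  exists (x * x0 ^ (- (w x %/ m%:Z)%Z)); split.
  - exact: (val_mulf_neq0 wP).
  - by rewrite e gez0_abs.
  - by rewrite absz_gt0.
move: r0 rm; lia.
Qed.

Section Residue.
Variables (q : nat).
Hypothesis qP : vge w 1 (q%:R : D).

(** In x^q - 1 = (x - 1)(1 + x + ... + x^(q-1)) the second factor is congruent to q, which lies in
    the maximal ideal; this gains one level. *)
Lemma vge_frob (m : int) x : vge w 0 x -> 1 <= m ->
  vge w m (x - 1) -> vge w (m + 1) (x ^+ q - 1).
Proof.
move=> hx hm h; rewrite subrX1; apply: (vgeM wP) => //.
have -> : \sum_(i < q) x ^+ i = \sum_(i < q) (x ^+ i - 1) + q%:R.
  by rewrite sumrB sumr_const card_ord subrK.
apply: (vgeD wP) => //; apply: (vge_sum wP) => i _.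
apply: (vge_le hm); rewrite -[1 in X in vge _ _ X](expr1n _ i).
by apply: vgeXB => //; exact: vge1.
Qed.

Lemma vge_frob_iter x : vge w 1 (x - 1) ->
  forall j : nat, vge w j.+1%:Z (x ^+ (q ^ j) - 1).
Proof.
move=> h; have hx : vge w 0 x.
  have -> : x = (x - 1) + 1 by rewrite subrK.
  by apply: (vgeD wP); [exact: vge_le h|exact: vge1].
elim=> [|j IH]; first by rewrite expn0 expr1.
rewrite expnSr exprM; have -> : j.+2%:Z = j.+1%:Z + 1 by lia.
by apply: vge_frob => //; exact: vgeX.
Qed.

End Residue.

(* Teichmueller representatives: a limit point of g^(q^j) is a root of unity *)
Lemma teichmuller : exists (zeta : D) (N : nat),
  [/\ (0 < N)%N, zeta ^+ N = 1, vge w 1 (N.+1%:R : D) &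
      forall x, vge w 0 x -> ~~ vge w 1 x -> exists j : nat, vge w 1 (x - zeta ^+ j)].
Proof.
have [s sO sP] := finite_residue.
have [x x0 wx|g [N [N0 gO gN NP hg]]] := residue_field_generator wP _ sO sP.
  exists x^-1; last by rewrite divrr ?mulVr ?Ddiv.
  by rewrite vge_ge ?invr_eq0 // (nvalV Hk Ddiv) // wx.
have [phi hphi [zeta hz]] := nval_seq_compact Hk Ddiv (fun j => vgeX wP (N.+1 ^ j) gO).
(* As g^(N+1) is congruent to g, all iterates stay in the residue class of g, and so does the
   limit. *)
have gg j : vge w 1 (g ^+ (N.+1 ^ j) - g).
  elim: j => [|j IH]; first by rewrite expn0 expr1 subrr vge0.
  rewrite expnSr exprM; apply: (@vge_trans _ _ wP _ _ (g ^+ N.+1)).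
    by apply: vgeXB => //; exact: vgeX.
  rewrite exprS -{3}[g]mulr1 -mulrBr; exact: vgeM0l.
have zg : vge w 1 (g - zeta).
  by apply: (vge_trans wP _ (hz 1%N)); rewrite (vgeBC wP).
have zO : vge w 0 zeta by apply: (vge_close wP (vge_le _ zg) gO).
exists zeta, N; split=> //.
(* The N-th powers of the iterates are iterates of the principal unit g^N, which tend to 1. *)
- apply/eqP; rewrite -subr_eq0; apply/eqP/(@vge_eq0 _ w) => m.
  apply: (@vge_trans _ _ wP _ _ ((g ^+ (N.+1 ^ phi m)) ^+ N)).
    by rewrite (vgeBC wP); apply: vgeXB => //; exact: vgeX.
  rewrite -exprM mulnC exprM; apply: vge_le (vge_frob_iter NP gN (phi m)).
  by have := homo_ltn_ge m hphi; lia.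
- move=> x hx hx1; have [j hj] := hg x hx hx1; exists j.
  by apply: (vge_trans wP hj); apply: vgeXB.
Qed.

Lemma vge_nat_alg (m : nat) : vge w 1 (m%:R : D) = vge v 1 (m%:R : k).
Proof. by rewrite -(vge_alg Hk Ddiv) scaler_nat. Qed.

(** * The involution preserves the valuation *)

Section Involution.
Variable rho : D -> D.
Hypothesis rhoD : forall a b, rho (a + b) = rho a + rho b.
Hypothesis rhoM : forall a b, rho (a * b) = rho b * rho a.
Hypothesis rho1 : rho 1 = 1.
Hypothesis rhoK : forall a, rho (rho a) = a.

Lemma rho0 : rho 0 = 0.
Proof. by have := rhoD 0 0; rewrite addr0 -{1}[rho 0]addr0 => /addrI. Qed.

Lemma rhoN x : rho (- x) = - rho x.
Proof. by apply/eqP; rewrite -addr_eq0 -rhoD addNr rho0. Qed.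

Lemma rhoB x y : rho (x - y) = rho x - rho y.
Proof. by rewrite rhoD rhoN. Qed.

Lemma rhoX x m : rho (x ^+ m) = rho x ^+ m.
Proof. by elim: m => [|m IH]; rewrite ?rho1 // exprS rhoM IH -exprSr. Qed.

Lemma rho_neq0 x : x != 0 -> rho x != 0.
Proof. by apply: contraNneq => h; rewrite -[x]rhoK h rho0. Qed.

Lemma rhoV x : x != 0 -> rho x^-1 = (rho x)^-1.
Proof.
move=> x0; have rx := Ddiv (rho_neq0 x0).
by apply: (mulIr rx); rewrite -rhoM divrr ?Ddiv // mulVr.
Qed.

(* Principal units are infinitely N-divisible, so the (discrete) valuation of
   their images under any ring (anti)automorphism vanishes. *)
Lemma rho_principal_unit x : vge w 1 (x - 1) -> w (rho x) = 0.
Proof.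
have [zeta [N [N0 _ NP _]]] := teichmuller.
(* N = 1 would put 2 into the maximal ideal; N > 1 makes the powers of N grow. *)
have N1 : (1 < N)%N.
  rewrite ltn_neqAle N0 andbT; apply/eqP => eN; move: NP.
  by rewrite -eN vge_nat_alg; apply/negP; exact: two_notin_ideal.
have prin y : vge w 1 (y - 1) -> y != 0 /\ vge w 0 y.
  move=> h; have [h1 h2] : y != 0 /\ w y = w 1.
    by apply: (w_close wP (oner_neq0 D)); rewrite (w1 wP) add0r (vgeBC wP).
  by split=> //; rewrite vge_ge // h2 (w1 wP).
have root y : vge w 1 (y - 1) -> exists2 z, vge w 1 (z - 1) & z ^+ N * y = 1.
  move=> hy; have [y0 yO] := prin y hy.
  (* Here e j = ((N+1)^j - 1)/N, so (y^(e j))^N y = y^((N+1)^j) tends to 1: a limit point z is an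
     N-th root of y^-1. *)
  pose e := fix e j := if j is j'.+1 then (N.+1 ^ j' + e j')%N else 0%N.
  have eP j : (e j * N + 1 = N.+1 ^ j)%N.
    by elim: j => // j IH; rewrite expnS mulSn -{2}IH /=; lia.
  have [phi hphi [z hz]] := nval_seq_compact Hk Ddiv (fun j => vgeX wP (e j) yO).
  have hz1 : vge w 1 (z - 1).
    apply: (@vge_trans _ _ wP _ _ (y ^+ e (phi 1))); first by rewrite (vgeBC wP) hz.
    by have := vgeXB wP (e (phi 1)) yO (vge1 wP) hy; rewrite expr1n.
  have [_ zO] := prin z hz1; exists z => //.
  apply/eqP; rewrite -subr_eq0; apply/eqP/(@vge_eq0 _ w) => m.
  apply: (@vge_trans _ _ wP _ _ ((y ^+ e (phi m)) ^+ N * y)).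
    rewrite -mulrBl; apply: vgeM0r => //.
    by rewrite (vgeBC wP); apply: vgeXB => //; exact: vgeX.
  rewrite -exprM -exprSr -addn1 eP; apply: vge_le (vge_frob_iter NP hy (phi m)).
  by have := homo_ltn_ge m hphi; lia.
have dvd j : forall y, vge w 1 (y - 1) -> exists c : int, w (rho y) = (N ^ j)%N%:Z * c.
  elim: j => [|j IH] y hy; first by exists (w (rho y)); rewrite expn0 mul1r.
  have [z hz zy] := root y hy; have [c hc] := IH z hz.
  have [y0 _] := prin y hy; have [z0 _] := prin z hz.
  exists (- c); have := congr1 w (congr1 rho zy).
  rewrite rhoM rho1 (w1 wP) rhoX (wM wP) ?rho_neq0 //; last first.
    by have [] := nvalX Hk Ddiv N (rho_neq0 z0).
  have [_ ->] := nvalX Hk Ddiv N (rho_neq0 z0); rewrite hc expnS PoszM => /eqP.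
  by rewrite addr_eq0 mulrN -mulrA => /eqP.
(* A value divisible by a power of N larger than its absolute value is 0. *)
move=> hx; have [c hc] := dvd (absz (w (rho x))) x hx.
have : (absz (w (rho x)) < N ^ absz (w (rho x)))%N by exact: ltn_expl.
move: hc; set a := (N ^ _)%N; move: (w (rho x)) => b hb hab.
have [c0|c0] := eqVneq c 0; first by rewrite hb c0 mulr0.
by exfalso; move: hab; rewrite hb abszM absz_nat; have := absz_gt0 c; rewrite c0; nia.
Qed.

(** If the value of rho(x) were negative, y = x^m Pi would for large m have positive value while
    rho(y) has negative value. Then rho(1 + y) has negative value, although 1 + y is a principal
    unit. *)
Lemma rho_integral x : vge w 0 x -> vge w 0 (rho x).
Proof.
have [Pi [Pi0 wPi _]] := exists_uniformizer.
have [->|x0] := eqVneq x 0; first by rewrite rho0 vge0.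
have rx0 := rho_neq0 x0; have rP0 := rho_neq0 Pi0.
rewrite !vge_ge // => wx; rewrite leNgt; apply/negP => wrx.
pose m := (absz (w (rho Pi))).+1; pose y := x ^+ m * Pi.
have [xm wxm] := nvalX Hk Ddiv m x0; have [rxm wrxm] := nvalX Hk Ddiv m rx0.
have y0 : y != 0 by exact: (val_mulf_neq0 wP).
have wy : vge w 1 (1 + y - 1).
  by rewrite addrAC subrr add0r vge_ge // (wM wP) // wxm; nia.
have := rho_principal_unit wy; rewrite rhoD rho1.
have ry0 : rho y != 0 by exact: rho_neq0.
have wry : w (rho y) < 0 by rewrite rhoM rhoX (wM wP) // wrxm /m; nia.
suff [_ ->] : 1 + rho y != 0 /\ w (1 + rho y) = w (rho y) by lia.
apply: (w_close wP ry0); rewrite opprD addrCA subrr addr0 (vgeN wP).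
by rewrite vge_ge ?oner_neq0 // (w1 wP); lia.
Qed.

(** If rho(x) were outside the ideal, its inverse would be integral, and applying rho would make
    x^-1 integral. *)
Lemma rho_ideal x : vge w 1 x -> vge w 1 (rho x).
Proof.
have [->|x0] := eqVneq x 0; first by rewrite rho0 vge0.
have rx0 := rho_neq0 x0.
have ix0 : (rho x)^-1 != 0 by rewrite invr_eq0.
rewrite !vge_ge // => wx; rewrite leNgt; apply/negP => wrx.
have : vge w 0 (rho (rho x)^-1).
  by apply: rho_integral; rewrite vge_ge // (nvalV Hk Ddiv) //; lia.
by rewrite rhoV // rhoK vge_ge ?invr_eq0 // (nvalV Hk Ddiv) //; lia.
Qed.

End Involution.

End LocalDivisionAlgebra.

(** * Generators of D, its dimension, and averaging *)

Lemma span_stable (k : fieldType) (A : falgType k) (X : seq A) (f : A -> A) :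
  linear f -> (forall x, x \in X -> f x \in <<X>>%VS) ->
  forall y, y \in <<X>>%VS -> f y \in <<X>>%VS.
Proof.
move=> fl hX y hy.
pose fL : {linear A -> A} := HB.pack f (GRing.isLinear.Build k A A _ f fl).
rewrite (coord_span (X := in_tuple X) hy) -[f]/(fL : A -> A) linear_sum.
by apply: rpred_sum => i _; rewrite linearZ rpredZ //; apply: hX; rewrite mem_nth.
Qed.

Lemma sum_ord_shift (A : zmodType) (N : nat) (F : nat -> A) : F N = F 0 ->
  \sum_(i < N) F i.+1 = \sum_(i < N) F i.
Proof.
move=> h; apply: (@addrI _ (F 0)).
by rewrite -(big_ord_recl N (fun i => F i)) big_ord_recr /= h addrC.
Qed.

Section Structure.
Variables (k : fieldType) (v : k -> int).
Hypothesis Hk : nonarch_local_field_odd v.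
Variable (D : falgType k).
Hypothesis Ddiv : forall x : D, x != 0 -> x \is a GRing.unit.
Implicit Types x y z : D.
Notation n := (dim D).
Notation w := (@nval k v D).
Let vP := local_valuative Hk.
Let wP : valuative w := nval_valuative Hk Ddiv.

Section Generators.
Variables (zeta Pi : D) (N : nat).
Hypothesis N0 : (0 < N)%N.
Hypothesis zN : zeta ^+ N = 1.
Hypothesis NP : vge w 1 (N.+1%:R : D).
Hypothesis zgen : forall x, vge w 0 x -> ~~ vge w 1 x -> exists j : nat, vge w 1 (x - zeta ^+ j).
Hypothesis Pi0 : Pi != 0.
Hypothesis wPi : 0 < w Pi.
Hypothesis Pigen : forall x, x != 0 -> exists q : int, w x = q * w Pi.

Lemma zeta_unit : zeta \is a GRing.unit.
Proof.
apply: Ddiv; apply: contraTneq N0 => z0; move: zN; rewrite z0.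
by case: N => // m; rewrite exprS mul0r => /esym/eqP; rewrite oner_eq0.
Qed.
Let zu := zeta_unit.
Let z0 : zeta != 0 := unit_neq0 zu.
Let Piu : Pi \is a GRing.unit := Ddiv Pi0.

Lemma w_zeta : w zeta = 0.
Proof.
have := congr1 w zN; rewrite (w1 wP); have [_ ->] := nvalX Hk Ddiv N z0.
by move/eqP; rewrite mulf_eq0 => /orP[|/eqP//]; clear -N0; lia.
Qed.

Lemma zetaO : vge w 0 zeta.
Proof. by rewrite vge_ge // w_zeta. Qed.
Let zO := zetaO.

(** The quotient u of the two powers is a principal unit with u^N = 1. If u differs from 1, then 1 +
    u + ... + u^(N-1) = 0 is congruent to N, so N and N + 1 would both lie in the ideal. *)
Lemma zeta_inj i j : vge w 1 (zeta ^+ i - zeta ^+ j) -> zeta ^+ i = zeta ^+ j.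
Proof.
(* The exponent (N - 1) j stands for -j modulo N. *)
move=> h; pose u := zeta ^+ (i + N.-1 * j).
have zj : zeta ^+ j * zeta ^+ (N.-1 * j) = 1.
  rewrite -exprD -mulSn prednK // exprM zN; exact: expr1n.
have hu : vge w 1 (u - 1).
  rewrite -zj /u exprD -mulrBl; apply: vgeM0r => //; exact: vgeX.
have uO : vge w 0 u by exact: vgeX.
have uN : u ^+ N = 1 by rewrite /u -exprM mulnC exprM zN expr1n.
have /eqP := subrX1 u N; rewrite uN subrr eq_sym => /eqP e.
suff u1 : u = 1.
  have : u * zeta ^+ j = zeta ^+ j by rewrite u1 mul1r.
  rewrite /u exprD -mulrA.
  have -> : zeta ^+ (N.-1 * j) * zeta ^+ j = zeta ^+ j * zeta ^+ (N.-1 * j).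
    by rewrite -!exprD addnC.
  by rewrite zj mulr1.
apply/eqP; rewrite -subr_eq0; apply: contraT => u1.
have s0 : \sum_(i < N) u ^+ i = 0.
  by have := congr1 (fun x => (u - 1)^-1 * x) e; rewrite mulr0 mulKr // Ddiv.
have : vge w 1 (N%:R : D).
  have -> : (N%:R : D) = - \sum_(i < N) (u ^+ i - 1).
    by rewrite sumrB s0 sumr_const card_ord sub0r opprK.
  rewrite (vgeN wP); apply: (vge_sum wP) => l _.
  by have := vgeXB wP l uO (vge1 wP) hu; rewrite expr1n.
move=> h1; have := vgeB wP NP h1; rewrite mulrS addrK.
by rewrite (vge_ge _ _ (oner_neq0 D)) (w1 wP).
Qed.

(** Modulo the ideal every unit is a power of zeta, and powers of zeta commute. *)
Lemma residue_comm x y : vge w 0 x -> vge w 0 y -> vge w 1 (x * y - y * x).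
Proof.
move=> hx hy.
have [hx1|hx1] := boolP (vge w 1 x).
  by apply: (vgeB wP); [exact: vgeM0r|exact: vgeM0l].
have [hy1|hy1] := boolP (vge w 1 y).
  by apply: (vgeB wP); [exact: vgeM0l|exact: vgeM0r].
have [i hi] := zgen hx hx1; have [j hj] := zgen hy hy1.
apply: (@vge_trans _ _ wP _ _ (zeta ^+ i * zeta ^+ j)).
  by apply: vgeMB => //; exact: vgeX.
rewrite -exprD addnC exprD (vgeBC wP); apply: vgeMB => //; exact: vgeX.
Qed.

Lemma residue_conj u x : u != 0 -> w u = 0 -> vge w 0 x -> vge w 1 (u * x * u^-1 - x).
Proof.
move=> u0 wu hx; have uu := Ddiv u0.
have -> : u * x * u^-1 - x = (u * x - x * u) * u^-1 by rewrite mulrBl mulrK.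
apply: vgeM0r => //; last by rewrite vge_ge ?invr_eq0 // (nvalV Hk Ddiv) // wu.
by apply: residue_comm => //; rewrite vge_ge // wu.
Qed.

Lemma zeta_conj_exists y : y != 0 -> exists r : nat, vge w 1 (y * zeta * y^-1 - zeta ^+ r).
Proof.
move=> y0; have iy0 : y^-1 != 0 by rewrite invr_eq0.
have h0 : y * zeta * y^-1 != 0 by rewrite !(val_mulf_neq0 wP).
have hw : w (y * zeta * y^-1) = 0.
  by rewrite !(wM wP) ?(val_mulf_neq0 wP) // (nvalV Hk Ddiv) // w_zeta addr0 subrr.
by apply: zgen; rewrite vge_ge // hw.
Qed.

(** The elements zeta^i Pi^j span a dense subspace, and subspaces of a finite-dimensional space are
    closed. *)
Lemma generators_dense (U : {vspace D}) :
  (forall i j : nat, zeta ^+ i * Pi ^+ j \in U) -> U = fullv.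
Proof.
move=> hU.
(* An error of exact value m is a unit times a power of Pi; approximating that unit by a power of
   zeta raises the value of the error. *)
have approx x (m : nat) : vge w 0 x -> exists2 u, u \in U & vge w m%:Z (x - u).
  move=> hx; elim: m => [|m [u uU hu]]; first by exists 0; rewrite ?mem0v ?subr0.
  have [h|h] := boolP (vge w m.+1%:Z (x - u)); first by exists u.
  have y0 : x - u != 0 by apply: contraNneq h => ->; exact: vge0.
  have wy : w (x - u) = m%:Z by move: hu h; rewrite !vge_ge // -ltNge intS [1 + _]addrC ltzD1 => h1 h2; apply/eqP; rewrite eq_le h1 h2.
  have [q hq] := Pigen y0.
  have q0 : 0 <= q by rewrite -(pmulr_lge0 _ wPi) -hq wy.
  have [j qj] : exists j : nat, q = j%:Z by exists (absz q); rewrite gez0_abs.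
  have [Pj wPj] := nvalX Hk Ddiv j Pi0.
  have iPj : (Pi ^+ j)^-1 != 0 by rewrite invr_eq0.
  have t0 : (x - u) * (Pi ^+ j)^-1 != 0 by exact: (val_mulf_neq0 wP).
  have wt : w ((x - u) * (Pi ^+ j)^-1) = 0.
    by rewrite (wM wP) // (nvalV Hk Ddiv) // wPj hq qj subrr.
  have [||i hi] := @zgen ((x - u) * (Pi ^+ j)^-1); [by rewrite vge_ge // wt..|].
  exists (u + zeta ^+ i * Pi ^+ j); first by rewrite rpredD.
  have -> : x - (u + zeta ^+ i * Pi ^+ j) = ((x - u) * (Pi ^+ j)^-1 - zeta ^+ i) * Pi ^+ j.
    by rewrite mulrBl mulrVK ?Ddiv // opprD addrA.
  rewrite intS.
  by apply: (vgeM wP) => //; rewrite vge_ge // wPj -qj -hq wy.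
apply/eqP; rewrite eqEsubv subvf /=; apply/subvP => x _.
wlog hx : x / vge w 0 x.
  move=> IH; have [x0|x0] := eqVneq x 0; first by rewrite x0 mem0v.
  have [t t0 vt] := exists_val Hk (absz (w x))%:Z.
  have : t *: x \in U.
    apply: IH; rewrite vge_ge ?scaler_eq0 ?negb_or ?t0 // (nvalZ Hk Ddiv) // vt.
    by move: (w x) (dim D) (dim_falg_gt0 D) => a m m0; clear -m0; nia.
  by move/(rpredZ t^-1); rewrite scalerA mulVf // scale1r.
apply: contraT => xU.
pose p := x - projv U x.
have p0 : p != 0.
  by apply: contraNneq xU => /eqP; rewrite subr_eq0 => /eqP->; exact: memv_proj.
have [i hi] : exists i, v2r p 0 i != 0.
  apply/existsP; apply: contraNT p0; rewrite negb_exists => /forallP h.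
  rewrite -(inj_eq (can_inj (@v2rK _ D))) linear0; apply/eqP/rowP => i; rewrite mxE.
  exact/eqP/negPn/h.
(* A continuous functional that vanishes on U but not at x: approximating x from U forces its value
   at x to be 0. *)
pose f z := v2r (z - projv U z) 0 i.
have flin c a b : f (c *: a + b) = c * f a + f b.
  rewrite /f linearP -[RHS]/(_ + _).
  have -> : c *: a + b - (c *: projv U a + projv U b) = c *: (a - projv U a) + (b - projv U b).
    by rewrite scalerBr opprD addrACA.
  by rewrite linearP !mxE.
have [C hC] := nval_functional_bound Hk Ddiv flin.
exfalso; move/eqP: hi; apply; apply: (@vge_eq0 _ v) => m.
have [u uU hu] := approx x (n * m + C)%N hx.
have -> : v2r p 0 i = f (x - u).
  have fu : f u = 0 by rewrite /f projv_id // subrr linear0 mxE.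
  by have := flin (-1) u x; rewrite scaleN1r addrC fu mulr0 add0r => ->.
by apply: hC.
Qed.

Hypothesis Dcent : forall z : D, (forall y, z * y = y * z) -> exists c : k, z = c%:A.

(** The centraliser of z is a subspace containing all zeta^i Pi^j, so [generators_dense] applies. *)
Lemma central_of_commutes z : z * zeta = zeta * z -> z * Pi = Pi * z -> exists c : k, z = c%:A.
Proof.
move=> h1 h2; apply: Dcent => y; apply/esym/cent1vP.
suff -> : ('C[z])%VS = fullv by rewrite memvf.
apply: generators_dense => i j; apply/cent1vP/esym.
have c1 := commrX i (h1 : GRing.comm z zeta); have c2 := commrX j (h2 : GRing.comm z Pi).
exact: commrM c1 c2.
Qed.

Variable r : nat.
Hypothesis Pizeta : Pi * zeta = zeta ^+ r * Pi.
Hypothesis zrr : zeta ^+ (r * r) = zeta.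

Lemma PizetaX i : Pi * zeta ^+ i = zeta ^+ (r * i) * Pi.
Proof.
elim: i => [|i IH]; first by rewrite muln0 !expr0 mulr1 mul1r.
by rewrite exprSr mulrA IH -mulrA Pizeta mulrA -exprD mulnS addnC.
Qed.

Lemma Pizetar : Pi * zeta ^+ r = zeta * Pi.
Proof. by rewrite PizetaX zrr. Qed.

Lemma Pi2_central : exists c : k, Pi * Pi = c%:A.
Proof.
apply: central_of_commutes; last by rewrite mulrA.
by rewrite -mulrA Pizeta mulrA Pizetar mulrA.
Qed.

(** Conjugation by Pi exchanges zeta and zeta^r, so it fixes their symmetric functions. *)
Lemma zeta_trace : exists a : k, zeta + zeta ^+ r = a%:A.
Proof.
apply: central_of_commutes.
  by rewrite mulrDl mulrDr -exprS -exprSr.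
by rewrite mulrDl mulrDr Pizeta Pizetar addrC.
Qed.

Lemma zeta_norm : exists b : k, zeta * zeta ^+ r = b%:A.
Proof.
apply: central_of_commutes.
  by rewrite -exprS -exprS -exprSr.
by rewrite [RHS]mulrA Pizeta -[RHS]mulrA Pizetar !mulrA -exprS -exprSr.
Qed.

(** Quadratic relations for zeta and Pi make the span of 1, zeta, Pi, zeta Pi stable under left
    multiplication by zeta and right multiplication by Pi; it therefore contains all zeta^i Pi^j. *)
Lemma generators_dim : (\dim {:D} <= 4)%N.
Proof.
have [a ha] := zeta_trace; have [b hb] := zeta_norm; have [c hc] := Pi2_central.
have z2 : zeta * zeta = a *: zeta - b%:A.
  by rewrite -hb -[a *: zeta]mulr_algl -ha mulrDl -exprS -exprSr addrK.
pose X := [:: 1; zeta; Pi; zeta * Pi].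
have inX y : y \in X -> y \in <<X>>%VS by exact: memv_span.
have X1 : 1 \in <<X>>%VS by apply: inX; rewrite !inE eqxx.
have Xz : zeta \in <<X>>%VS by apply: inX; rewrite !inE eqxx orbT.
have XP : Pi \in <<X>>%VS by apply: inX; rewrite !inE eqxx !orbT.
have XzP : zeta * Pi \in <<X>>%VS by apply: inX; rewrite !inE eqxx !orbT.
have lz y : y \in <<X>>%VS -> zeta * y \in <<X>>%VS.
  apply: span_stable => [d e f|x]; first by rewrite mulrDr scalerAr.
  rewrite !inE => /or4P[] /eqP->; rewrite ?mulr1 //.
    by rewrite z2 rpredB ?rpredZ.
  by rewrite mulrA z2 mulrBl -scalerAl mulr_algl rpredB ?rpredZ.
have rP y : y \in <<X>>%VS -> y * Pi \in <<X>>%VS.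
  apply: (@span_stable _ _ _ (fun y => y * Pi)) => [d e f|x]; first by rewrite mulrDl scalerAl.
  rewrite !inE => /or4P[] /eqP->; rewrite ?mul1r //.
    by rewrite hc rpredZ.
  by rewrite -mulrA hc mulr_algr rpredZ.
have <- : <<X>>%VS = fullv.
  apply: generators_dense => i j.
  elim: j => [|j IH]; last by rewrite exprSr mulrA rP.
  by rewrite expr0 mulr1; elim: i => [|i IH] //; rewrite exprS lz.
exact: dim_span.
Qed.

(** Cyclic reindexing shows that P commutes with zeta, hence so does its conjugate by Pi. As Pi^2 is
    central, conjugation by Pi exchanges the two summands. *)
Lemma averaging_central x :
  let P := \sum_(i < N) zeta ^+ i * x * (zeta ^+ i)^-1 in
  exists c : k, P + Pi * P * Pi^-1 = c%:A.
Proof.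
move=> P.
have Pz : zeta * P = P * zeta.
  pose F i := zeta ^+ i * x * (zeta ^+ i)^-1.
  have e : \sum_(i < N) F i.+1 = P by apply: sum_ord_shift; rewrite /F zN expr0.
  have : zeta * P * zeta^-1 = P.
    rewrite -[RHS]e /P mulr_sumr mulr_suml; apply: eq_bigr => i _; rewrite /F.
    by rewrite exprS invrM ?unitrX // !mulrA.
  by move=> h; rewrite -{2}h mulrVK.
have zP : GRing.comm P (zeta ^+ r) by apply: commrX; rewrite /GRing.comm Pz.
have [c hc] := Pi2_central.
apply: central_of_commutes.
  rewrite mulrDl mulrDr Pz; congr (_ + _).
  have h : Pi^-1 * zeta = zeta ^+ r * Pi^-1.
    by apply: (mulrI Piu); rewrite mulVKr // mulrA Pizetar mulrK.
  by rewrite -[LHS]mulrA h mulrA -[Pi * P * _]mulrA zP mulrA Pizetar !mulrA.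
rewrite mulrDl mulrDr mulrVK // addrC; congr (_ + _).
have -> : Pi * (Pi * P * Pi^-1) = Pi * Pi * P * Pi^-1 by rewrite !mulrA.
by rewrite hc mulr_algl -[P in RHS]mulr1 scalerAr -hc mulrA mulrK.
Qed.

End Generators.

(* Averaging zeta^(ri) Pi zeta^(-i) turns the congruence into an equality. *)
Lemma normalized_uniformizer zeta Pi N r : (0 < N)%N -> zeta ^+ N = 1 ->
  vge w 1 (N.+1%:R : D) -> Pi != 0 -> vge w 1 (Pi * zeta * Pi^-1 - zeta ^+ r) ->
  exists Pi' : D, [/\ Pi' != 0, w Pi' = w Pi & Pi' * zeta = zeta ^+ r * Pi'].
Proof.
move=> N0 zN NP Pi0 hr; have zu := zeta_unit N0 zN; have zO := zetaO N0 zN.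
have Piu := Ddiv Pi0.
pose F i := zeta ^+ (r * i) * Pi * (zeta ^+ i)^-1.
pose Pi' := \sum_(i < N) F i.
have FN : F N = F 0%N by rewrite /F zN mulnC exprM zN expr1n muln0 !expr0.
have e1 : Pi' * zeta = zeta ^+ r * Pi'.
  rewrite -[Pi' in LHS](sum_ord_shift FN) mulr_suml /Pi' mulr_sumr.
  apply: eq_bigr => i _; rewrite /F mulnS exprD exprS invrM ?unitrX // !mulrA.
  by rewrite mulrVK.
have PiO : vge w (w Pi) Pi by rewrite vge_ge.
have hF i : vge w (w Pi + 1) (F i - Pi).
  have hz : vge w 0 (zeta ^+ i)^-1.
    rewrite vge_ge ?invr_eq0 ?unit_neq0 ?unitrX // (nvalV Hk Ddiv) ?unit_neq0 ?unitrX //.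
    have [_ ->] := nvalX Hk Ddiv i (unit_neq0 zu).
    by rewrite (w_zeta N0 zN) mulr0 oppr0.
  have -> : F i - Pi = (zeta ^+ (r * i) * Pi - Pi * zeta ^+ i) * (zeta ^+ i)^-1.
    by rewrite mulrBl mulrK ?unitrX.
  apply: (vgeM0r wP) => //.
  elim: i {hz} => [|i IH]; first by rewrite muln0 !expr0 mulr1 mul1r subrr vge0.
  have -> : zeta ^+ (r * i.+1) * Pi - Pi * zeta ^+ i.+1 =
    zeta ^+ (r * i) * (zeta ^+ r * Pi - Pi * zeta) +
    (zeta ^+ (r * i) * Pi - Pi * zeta ^+ i) * zeta.
    by rewrite mulrBr mulrBl mulnSr exprD exprSr !mulrA addrA subrK.
  apply: (vgeD wP); last exact: vgeM0r.
  apply: (vgeM0l wP); first exact: vgeX.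
  have -> : zeta ^+ r * Pi - Pi * zeta = - ((Pi * zeta * Pi^-1 - zeta ^+ r) * Pi).
    by rewrite mulrBl mulrVK // opprB.
  by rewrite (vgeN wP) addrC; apply: (vgeM wP).
(* N is congruent to -1, so it has value 0; the sum [Pi'] is close to N Pi and thus has the value of
   Pi. *)
have wN : (N%:R : D) != 0 /\ w (N%:R : D) = w (-1).
  apply: (w_close wP); first by rewrite oppr_eq0 oner_neq0.
  by rewrite (wN1 wP) add0r -opprD (vgeN wP) addrC -mulrSr.
case: wN => N0' wN.
have NPi0 : N%:R * Pi != 0 by exact: (val_mulf_neq0 wP).
have wNPi : w (N%:R * Pi) = w Pi by rewrite (wM wP) // wN (wN1 wP) add0r.
have [|h1 h2] := w_close wP (y := Pi') NPi0.
  rewrite wNPi (vgeBC wP) mulr_natl -[N in _ *+ N]card_ord -sumr_const -sumrB.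
  exact: (vge_sum wP).
by exists Pi'; rewrite h2.
Qed.

Hypothesis Dcent : forall z : D, (forall y, z * y = y * z) -> exists c : k, z = c%:A.
Variable rho : D -> D.
Hypothesis rhoD : forall a b, rho (a + b) = rho a + rho b.
Hypothesis rhoM : forall a b, rho (a * b) = rho b * rho a.
Hypothesis rho1 : rho 1 = 1.
Hypothesis rhoK : forall a, rho (rho a) = a.

(* Conjugation by a uniformizer and rho both act on the residue field through
   powers of zeta, hence commute; as rho reverses products, the former has
   order at most two. *)
Lemma uniformizer_conj_involutive zeta N Pi r :
  (0 < N)%N -> zeta ^+ N = 1 -> vge w 1 (N.+1%:R : D) ->
  (forall x, vge w 0 x -> ~~ vge w 1 x -> exists j : nat, vge w 1 (x - zeta ^+ j)) ->
  Pi != 0 -> 0 < w Pi -> (forall x, x != 0 -> exists q : int, w x = q * w Pi) ->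
  Pi * zeta = zeta ^+ r * Pi -> zeta ^+ (r * r) = zeta.
Proof.
move=> N0 zN NP zgen Pi0 wPi Pigen Pz.
have zu := zeta_unit N0 zN; have zO := zetaO N0 zN; have z0 := unit_neq0 zu.
have Piu := Ddiv Pi0.
have rO := rho_integral Hk Ddiv rhoD rhoM rho1 rhoK.
have rI := rho_ideal Hk Ddiv rhoD rhoM rho1 rhoK.
have rPi0 := rho_neq0 rhoD rhoK Pi0; have rz0 := rho_neq0 rhoD rhoK z0.
have rX := rhoX rhoM rho1.
have rz1 : ~~ vge w 1 (rho zeta).
  apply/negP => /rI; rewrite rhoK vge_ge // (w_zeta N0 zN); by [].
have [s hs] := zgen _ (rO _ zO) rz1.
have wge x : x != 0 -> vge w 1 x -> w Pi <= w x.
  move=> x0; have [q hq] := Pigen x x0; rewrite vge_ge // hq -gtz0_ge1 (pmulr_lgt0 _ wPi).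
  by rewrite gtz0_ge1 -{1}[w Pi]mul1r (ler_pM2r wPi).
have wrPi : w (rho Pi) = w Pi.
  have h1 : w Pi <= w (rho Pi).
    by apply: wge => //; apply: rI; rewrite vge_ge // -gtz0_ge1.
  have iP0 : Pi^-1 != 0 by rewrite invr_eq0.
  have h2 : vge w 0 (rho (rho Pi * Pi^-1)).
    by apply: rO; rewrite vge_ge ?(val_mulf_neq0 wP) // (wM wP) // (nvalV Hk Ddiv) // subr_ge0.
  move: h2; rewrite rhoM rhoK (rhoV Ddiv rhoD rhoM rho1 rhoK) //.
  have iP0' : (rho Pi)^-1 != 0 by rewrite invr_eq0.
  rewrite vge_ge ?(val_mulf_neq0 wP) // (wM wP) // (nvalV Hk Ddiv) // addrC subr_ge0 => h3.
  by apply/eqP; rewrite eq_le h3 h1.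
(* rho(Pi) is again a uniformizer, and the unit u acts trivially on the residue field; so both
   uniformizers induce the same power map. *)
pose u := rho Pi * Pi^-1.
have u0 : u != 0 by rewrite (val_mulf_neq0 wP) ?invr_eq0.
have wu : w u = 0 by rewrite (wM wP) ?invr_eq0 // (nvalV Hk Ddiv) // wrPi subrr.
have rPiE : rho Pi = u * Pi by rewrite mulrVK.
have e1 : rho zeta * rho Pi = rho Pi * rho zeta ^+ r.
  by rewrite -rhoM Pz rhoM rX.
have PzX i : Pi * zeta ^+ i = zeta ^+ (r * i) * Pi by exact: PizetaX Pz i.
(* With rho(zeta) congruent to zeta^s, this is rho applied to Pi zeta = zeta^r Pi, read modulo the
   ideal. *)
have hz1 : vge w 1 (zeta ^+ s - zeta ^+ (r * (s * r))).
  apply: (@vge_trans _ _ wP _ _ (rho zeta)); first by rewrite (vgeBC wP).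
  have -> : rho zeta = rho Pi * rho zeta ^+ r * (rho Pi)^-1 by rewrite -e1 mulrK ?Ddiv.
  apply: (@vge_trans _ _ wP _ _ (rho Pi * zeta ^+ (s * r) * (rho Pi)^-1)).
    rewrite -mulrBl -mulrBr.
    apply: (@vge_le _ _ _ (w (rho Pi) + 1 + - w (rho Pi))); first by rewrite addrAC subrr add0r.
    apply: (vgeM wP); last by rewrite vge_ge ?invr_eq0 // (nvalV Hk Ddiv).
    apply: (vgeM wP); first by rewrite vge_ge.
    by rewrite exprM; apply: vgeXB => //; [exact: rO|exact: vgeX].
  rewrite rPiE invrM ?Ddiv // -[u * Pi * _]mulrA PzX !mulrA mulrK //.
  apply: (residue_conj N0 zN) => //; exact: vgeX.
(* This is rho^2 = id on the residue field. *)
have hz2 : vge w 1 (zeta - zeta ^+ (s * s)).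
  rewrite -{1}[zeta]rhoK; apply: (@vge_trans _ _ wP _ _ (rho (zeta ^+ s))).
    by rewrite -(rhoB rhoD); apply: rI.
  by rewrite rX exprM; apply: vgeXB => //; [exact: rO|exact: vgeX].
(* Modulo the ideal, zeta = zeta^(s^2) = zeta^(r^2 s^2) = zeta^(r^2); [zeta_inj] turns this into an
   equality. *)
apply/esym; rewrite -{1}[zeta]expr1; apply: (zeta_inj N0 zN NP); rewrite expr1.
apply: (vge_trans wP hz2); rewrite exprM.
apply: (@vge_trans _ _ wP _ _ ((zeta ^+ (r * (s * r))) ^+ s)).
  by apply: vgeXB => //; exact: vgeX.
have -> : (zeta ^+ (r * (s * r))) ^+ s = (zeta ^+ (s * s)) ^+ (r * r).
  by rewrite -!exprM [(r * (s * r))%N]mulnC -mulnA [(r * s)%N]mulnC mulnACA.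
by rewrite (vgeBC wP); apply: vgeXB => //; exact: vgeX.
Qed.

(** The list consists of the 2N elements zeta^i and Pi zeta^i. Its length is prime to the residue
    characteristic because N is congruent to -1 and 2 is a unit. *)
Theorem involution_structure : (\dim {:D} <= 4)%N /\
  exists us : seq D, [/\ forall u, u \in us -> u \is a GRing.unit,
    ~~ vge v 1 ((size us)%:R : k) &
    forall x, exists c : k, \sum_(u <- us) u * x * u^-1 = c%:A].
Proof.
have [zeta [N [N0 zN NP zgen]]] := teichmuller Hk Ddiv.
have [Pi1 [Pi10 wPi1 Pi1gen]] := exists_uniformizer Hk Ddiv.
have [r hr] := zeta_conj_exists N0 zN zgen Pi10.
have [Pi [Pi0 wPi Pz]] := normalized_uniformizer N0 zN NP Pi10 hr.
rewrite -wPi in wPi1 Pi1gen.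
have zrr := uniformizer_conj_involutive N0 zN NP zgen Pi0 wPi1 Pi1gen Pz.
have zu := zeta_unit N0 zN; have Piu := Ddiv Pi0.
split; first exact: (generators_dim zgen Pi0 wPi1 Pi1gen Dcent Pz zrr).
exists ([seq zeta ^+ i | i <- index_iota 0 N] ++ [seq Pi * zeta ^+ i | i <- index_iota 0 N]); split.
- move=> u; rewrite mem_cat => /orP[] /mapP[i _ ->]; first by rewrite unitrX.
  by rewrite unitrMl ?unitrX.
- rewrite size_cat !size_map size_iota subn0 addnn -muln2 natrM.
  apply/negP => h; have/negP := two_notin_ideal Hk; apply.
  rewrite (vge_nat_alg Hk Ddiv) in NP.
  have := vgeB vP (vgeM0r vP NP (vge_nat vP 2)) h.
  by rewrite -mulrBl mulrS addrK mul1r.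
- move=> x.
  have [c hc] := averaging_central N0 zN zgen Pi0 wPi1 Pi1gen Dcent Pz zrr x.
  exists c; rewrite -hc big_cat /= !big_map !big_mkord; congr (_ + _).
  rewrite mulr_sumr mulr_suml; apply: eq_bigr => i _.
  by rewrite invrM ?unitrX // !mulrA.
Qed.

End Structure.

(** * Algebra homomorphisms and coprime tensor products *)

Section AlgebraHom.
Variables (k : fieldType) (A B : falgType k) (f : A -> B).
Hypothesis fD : forall x y, f (x + y) = f x + f y.
Hypothesis fZ : forall (c : k) x, f (c *: x) = c *: f x.
Hypothesis fM : forall x y, f (x * y) = f x * f y.
Hypothesis f1 : f 1 = 1.

Lemma hom_linear : linear f. Proof. by move=> c x y; rewrite fD fZ. Qed.
Definition hom_lin : {linear A -> B} := HB.pack f (GRing.isLinear.Build k A B _ f hom_linear).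

Lemma homX x i : f (x ^+ i) = f x ^+ i.
Proof. by elim: i => [|i IH]; rewrite ?f1 // !exprS fM IH. Qed.

Lemma hom_horner (p : {poly k}) x :
  (map_poly (in_alg B) p).[f x] = f (map_poly (in_alg A) p).[x].
Proof.
rewrite !horner_coef !size_map_poly -[f]/(hom_lin : A -> B) linear_sum.
by apply: eq_bigr => i _; rewrite !coef_map /= !mulr_algl fZ homX.
Qed.

Hypothesis Adiv : forall x : A, x != 0 -> x \is a GRing.unit.

Lemma hom_eq0 x : f x = 0 -> x = 0.
Proof.
move=> fx; apply/eqP; apply: contraT => x0; have := congr1 f (divrr (Adiv x0)).
by rewrite fM fx mul0r f1 => /esym/eqP; rewrite oner_eq0.
Qed.

(** An injective homomorphism preserves and reflects polynomial equations. Integrality can thus be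
    compared across E, D and Delta without ramification indices. *)
Lemma int_ring_hom (v : k -> int) x : int_ring v (f x) <-> int_ring v x.
Proof.
split=> -[p [pm pO /rootP pr]]; exists p; split=> //; apply/rootP.
  by apply: hom_eq0; rewrite -hom_horner.
by rewrite hom_horner pr -[f]/(hom_lin : A -> B) linear0.
Qed.

(** U is a vector space over the division algebra A. Starting from 0, one adjoins lines A y with y
    outside the current submodule; each has dimension dim A and meets it trivially. *)
Lemma dim_dvd_module (U : {vspace B}) :
  (forall a u, u \in U -> f a * u \in U) -> (\dim {:A} %| \dim U)%N.
Proof.
move=> hU.
suff H m : forall U0 : {vspace B}, (U0 <= U)%VS ->
    (forall a u, u \in U0 -> f a * u \in U0) -> (\dim {:A} %| \dim U0)%N ->
    (\dim U - \dim U0 <= m)%N -> (\dim {:A} %| \dim U)%N.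
  apply: (H (\dim U) 0%VS); rewrite ?sub0v ?dimv0 ?dvdn0 ?subn0 //.
  by move=> a u; rewrite !memv0 => /eqP->; rewrite mulr0.
elim: m => [|m IH] U0 sU hU0 dU0 hm.
  have -> : \dim U = \dim U0 by have := dimvS sU; lia.
  exact: dU0.
have [sU'|/subvPn[y yU yU0]] := boolP (U <= U0)%VS.
  by have -> : U = U0 by apply/eqP; rewrite eqEsubv sU' sU.
have glin : linear (fun a => f a * y) by move=> c a b; rewrite fD fZ mulrDl scalerAl.
pose g : {linear A -> B} := HB.pack (fun a => f a * y) (GRing.isLinear.Build k A B _ _ glin).
have memW a : f a * y \in limg (linfun g) by rewrite -[f a * y]/(g a) -lfunE memv_img ?memvf.
have cap a : f a * y \in U0 -> a = 0.
  move=> h; apply/eqP; apply: contraT => a0; case/negP: yU0.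
  have := hU0 a^-1 _ h; by rewrite mulrA -fM mulVr ?Adiv // f1 mul1r.
have dW : \dim (limg (linfun g)) = \dim {:A}.
  apply: limg_dim_eq; apply/eqP; rewrite -subv0; apply/subvP => a.
  rewrite memv_cap memv_ker lfunE memv0 => /andP[_ /eqP /= h]; apply/eqP.
  by apply: cap; rewrite h mem0v.
have dS : \dim (U0 + limg (linfun g)) = (\dim U0 + \dim {:A})%N.
  rewrite dimv_disjoint_sum ?dW //; apply/eqP; rewrite -subv0; apply/subvP => z.
  rewrite memv_cap => /andP[zU /memv_imgP[a _]]; rewrite lfunE /= => zE.
  by rewrite zE in zU *; rewrite (cap a zU) -[f 0]/(hom_lin 0) linear0 mul0r mem0v.
have A0 : (0 < \dim {:A})%N by rewrite dimvf dim_falg_gt0.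
apply: (IH (U0 + limg (linfun g))%VS).
- rewrite subv_add sU; apply/subvP => z /memv_imgP[a _ ->]; rewrite lfunE /=.
  exact: hU.
- move=> a u /memv_addP[u0 u0U [z /memv_imgP[b _ ->] ->]]; rewrite lfunE /= mulrDr mulrA -fM.
  by apply: memv_add => //; exact: hU0.
- by rewrite dS dvdn_add.
- rewrite dS; lia.
Qed.

End AlgebraHom.

(* A left ideal is a module over both factors, so coprimality of their
   dimensions leaves no room for a proper non-zero one. *)
Lemma coprime_tensor_division (k : fieldType) (A B C : falgType k) (f : A -> C) (g : B -> C) :
  (forall x y, f (x + y) = f x + f y) -> (forall (c : k) x, f (c *: x) = c *: f x) ->
  (forall x y, f (x * y) = f x * f y) -> f 1 = 1 ->
  (forall x y, g (x + y) = g x + g y) -> (forall (c : k) x, g (c *: x) = c *: g x) ->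
  (forall x y, g (x * y) = g x * g y) -> g 1 = 1 ->
  (forall x : A, x != 0 -> x \is a GRing.unit) ->
  (forall x : B, x != 0 -> x \is a GRing.unit) ->
  coprime (\dim {:A}) (\dim {:B}) -> \dim {:C} = (\dim {:A} * \dim {:B})%N ->
  forall z : C, z != 0 -> z \is a GRing.unit.
Proof.
move=> fD fZ fM f1 gD gZ gM g1 Adiv Bdiv cop dimC.
have linv z : z != 0 -> exists y : C, y * z = 1.
  move=> z0.
  have hlin : linear (fun x : C => x * z) by move=> c a b; rewrite mulrDl scalerAl.
  pose h : {linear C -> C} := HB.pack (fun x : C => x * z) (GRing.isLinear.Build k C C _ _ hlin).
  pose U := limg (linfun h).
  have UP x : x \in U -> exists y, x = y * z.
    by move=> /memv_imgP[y _ ->]; exists y; rewrite lfunE.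
  have UI y : y * z \in U by rewrite -[y * z]/(h y) -lfunE memv_img ?memvf.
  have dvA : (\dim {:A} %| \dim U)%N.
    by apply: (dim_dvd_module fD fZ fM f1 Adiv) => a u /UP[y ->]; rewrite mulrA.
  have dvB : (\dim {:B} %| \dim U)%N.
    by apply: (dim_dvd_module gD gZ gM g1 Bdiv) => a u /UP[y ->]; rewrite mulrA.
  have dvC : (\dim {:C} %| \dim U)%N by rewrite dimC Gauss_dvd // dvA.
  have U0 : (0 < \dim U)%N.
    rewrite lt0n dimv_eq0; apply: contraNneq z0 => U0.
    by have := UI 1; rewrite mul1r U0 memv0.
  have UT : U = fullv.
    by apply/eqP; rewrite eqEdim subvf dvdn_leq.
  by have [y ->] := UP 1 (eq_ind_r (fun V : {vspace C} => 1 \in V) (memvf 1) UT); exists y.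
move=> z z0; have [y yz] := linv z z0.
have y0 : y != 0 by apply: contraTneq (oner_neq0 C) => y0; rewrite -yz y0 mul0r eqxx.
have [x xy] := linv y y0.
have xz : x = z by rewrite -[x]mulr1 -yz mulrA xy mul1r.
by apply/unitrP; exists y; rewrite yz -{1}xz xy.
Qed.

Lemma sqr_le4_coprime_odd (m d e : nat) : (0 < m)%N -> (m <= 4)%N -> m = (d ^ 2)%N ->
  odd e -> coprime e m.
Proof.
move=> m0 m4 md oe; rewrite md coprimeXr //.
have : (d <= 2)%N by nia.
case: d md => [|[|[|d]]] //= md _; first by lia.
  exact: coprimen1.
by rewrite coprimen2.
Qed.

(** * The functional lambda on the maximal ideal of E *)

Section SymmetricFunctional.
Variables (k : fieldType) (v : k -> int) (E : fieldExtType k) (sig : E -> E) (rk : k -> k).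
Variable lam : E -> k.
Hypothesis Hk : nonarch_local_field_odd v.
Hypothesis sigD : forall x y, sig (x + y) = sig x + sig y.
Hypothesis sigM : forall x y, sig (x * y) = sig x * sig y.
Hypothesis sig1 : sig 1 = 1.
Hypothesis sigK : forall x, sig (sig x) = x.
Hypothesis sigk : forall c : k, sig (c%:A) = (rk c)%:A.
Hypothesis lamP : forall (c : k) (x y : E), lam (c *: x + y) = c * lam x + lam y.
Hypothesis lam_sig : forall x, lam (sig x) = rk (lam x).
Notation w := (@nval k v E).

Lemma field_ext_div (x : E) : x != 0 -> x \is a GRing.unit.
Proof. by rewrite unitfE. Qed.

(** Write 2x = (x + sig x) + (x - sig x), where 2 is a unit. The first summand is symmetric; the
    second becomes symmetric after division by its image under [lam], which [rk] negates. *)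
Lemma lam_ideal :
  (forall x, sig x = x -> vge w 1 x -> vge v 1 (lam x)) ->
  forall x, vge w 1 x -> vge v 1 (lam x).
Proof.
move=> hsym x hx.
have vP := local_valuative Hk; have wP := nval_valuative Hk field_ext_div.
have sI := rho_ideal Hk field_ext_div sigD (fun a b => etrans (sigM a b) (mulrC _ _)) sig1 sigK.
have sN y : sig (- y) = - sig y by exact: (rhoN sigD).
have lD a b : lam (a + b) = lam a + lam b by rewrite -[a]scale1r lamP mul1r scale1r.
have l0 : lam 0 = 0 by have := lD 0 0; rewrite addr0 -{1}[lam 0]addr0 => /addrI.
have lZ c a : lam (c *: a) = c * lam a by rewrite -[c *: a]addr0 lamP l0 addr0.
have lN a : lam (- a) = - lam a by rewrite -scaleN1r lZ mulN1r.
pose x1 := x - sig x; pose c := lam x1.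
have hx1 : vge w 1 x1 by apply: (vgeB wP) => //; exact: sI.
have sx1 : sig x1 = - x1 by rewrite /x1 sigD sN sigK opprB addrC.
have hc : vge v 1 c.
  (* otherwise c^-1 x1 is symmetric and in the ideal, yet lam maps it to 1 *)
  apply: contraT => nc.
  have c0 : c != 0 by apply: contraNneq nc => ->; exact: vge0.
  have vc : v c <= 0 by move: nc; rewrite vge_ge // -ltNge -[1]add0r ltzD1.
  have rkc : (rk c)%:A = - (c%:A) :> E by rewrite -lam_sig sx1 lN scaleNr.
  have cA : (c%:A : E) != 0 by rewrite scaler_eq0 negb_or c0 oner_neq0.
  have sc : sig (c^-1)%:A = - (c^-1)%:A.
    apply: (mulIf cA); rewrite -[c%:A in LHS]opprK -rkc -sigk mulrN -sigM.
    by rewrite -scalerAl mul1r scalerA mulVf // scale1r sig1 mulNr -scalerAl mul1r scalerA mulVf // scale1r.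
  have ssy : sig (c^-1 *: x1) = c^-1 *: x1.
    by rewrite -mulr_algl sigM sc sx1 mulrNN.
  have : vge v 1 (lam (c^-1 *: x1)).
    apply: hsym => //; have [->|x10] := eqVneq x1 0; first by rewrite scaler0 vge0.
    move: hx1; rewrite !vge_ge ?scaler_eq0 ?negb_or ?invr_eq0 ?c0 //.
    rewrite (nvalZ Hk field_ext_div) ?invr_eq0 //.
    have -> : v c^-1 = - v c.
      have := wM vP c0 (_ : c^-1 != 0); rewrite divff // (w1 vP) invr_eq0 => /(_ c0) h.
      by apply/eqP; rewrite -addr_eq0 addrC -h.
    move=> h; apply: le_trans h _; rewrite lerDr mulr_ge0 // oppr_ge0.
    exact: vc.
  by rewrite lZ mulVf // (vge_ge _ _ (oner_neq0 k)) (w1 vP).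
have h2 : vge v 1 (2%:R * lam x).
  have -> : 2%:R * lam x = lam (x + sig x) + c.
    by rewrite /c -lD /x1 addrACA subrr addr0 lD mulr_natl mulr2n.
  apply: (vgeD vP) => //; apply: hsym; first by rewrite sigD sigK addrC.
  by apply: (vgeD wP) => //; exact: sI.
have [->|l0'] := eqVneq (lam x) 0; first exact: vge0.
have /negP t := two_notin_ideal Hk.
have t0 : (2%:R : k) != 0 by apply/eqP => t0; apply: t; rewrite t0 vge0.
have vt : v (2%:R : k) = 0.
  apply/eqP; rewrite eq_le -(vge_ge v 0 t0) (vge_nat vP) andbT.
  rewrite leNgt; apply/negP => h; apply: t; rewrite vge_ge // -gtz0_ge1; exact: h.
by move: h2; rewrite !vge_ge ?mulf_neq0 // (wM vP) // vt add0r.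
Qed.

End SymmetricFunctional.

(** * Equality of the two dual lattices *)

Theorem mainTheorem9
  (* the local field k *)
  (k : fieldType) (v : k -> int) (Hk : nonarch_local_field_odd v)
  (* central division algebra D of index d *)
  (D : falgType k) (d : nat)
  (HDdiv : forall x : D, x != 0 -> x \is a GRing.unit)
  (HDcent : forall z : D, (forall y, z * y = y * z) -> exists c : k, z = c%:A)
  (HDdim : \dim (@fullv _ D) = (d ^ 2)%N)
  (* right D-vector space V *)
  (V : zmodType) (act : V -> D -> V)
  (Hact_addl : forall u w a, act (u + w) a = act u a + act w a)
  (Hact_addr : forall u a b, act u (a + b) = act u a + act u b)
  (Hact1 : forall u, act u 1 = u)
  (HactM : forall u a b, act (act u a) b = act u (a * b))
  (HVfin : exists s : seq V, forall x, exists b : nat -> D,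
      x = \sum_(i < size s) act s`_i (b i))
  (* the anti-automorphism rho of D, rho^2 = id, and its restriction to k *)
  (rho : D -> D) (rk : k -> k)
  (Hrho_add : forall a b, rho (a + b) = rho a + rho b)
  (Hrho_mul : forall a b, rho (a * b) = rho b * rho a)
  (Hrho1 : rho 1 = 1)
  (Hrho2 : forall a, rho (rho a) = a)
  (Hrk : forall c : k, rho (c%:A) = (rk c)%:A)
  (* epsilon and the epsilon-hermitian form h *)
  (eps : D) (Heps : eps = 1 \/ eps = -1)
  (h : V -> V -> D)
  (Hh_addl : forall u u' w, h (u + u') w = h u w + h u' w)
  (Hh_addr : forall u w w', h u (w + w') = h u w + h u w')
  (Hh_sesq : forall u w a b, h (act u a) (act w b) = rho a * h u w * b)
  (Hh_herm : forall u w, h w u = eps * rho (h u w))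
  (Hh_nondeg : forall u, (forall w, h u w = 0) -> u = 0)
  (* the field extension E|k, sigma', lambda *)
  (E : fieldExtType k) (sig' : E -> E)
  (Hsig'_add : forall x y, sig' (x + y) = sig' x + sig' y)
  (Hsig'_mul : forall x y, sig' (x * y) = sig' x * sig' y)
  (Hsig'1 : sig' 1 = 1)
  (Hsig'2 : forall x, sig' (sig' x) = x)
  (Hsig'k : forall c : k, sig' (c%:A) = (rk c)%:A)
  (lam : E -> k)
  (Hlam_lin : forall (c : k) (x y : E), lam (c *: x + y) = c * lam x + lam y)
  (Hlam_nz : exists x, lam x != 0)
  (Hlam_sig : forall x, lam (sig' x) = rk (lam x))
  (Hlam_norm : forall x : E, sig' x = x ->
      (int_ideal v x <-> (forall y : E, sig' y = y -> int_ring v y ->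
                             val_ideal v (lam (x * y)))))
  (* [E:k] odd *)
  (HEodd : odd (\dim (@fullv _ E)))
  (* Delta = E (x)_k D: a k-algebra with commuting k-algebra maps from E and D
     inducing an isomorphism E (x)_k D ~ Delta *)
  (Delta : falgType k) (iE : E -> Delta) (iD : D -> Delta)
  (HiE_add : forall x y, iE (x + y) = iE x + iE y)
  (HiE_mul : forall x y, iE (x * y) = iE x * iE y)
  (HiE1 : iE 1 = 1)
  (HiE_scal : forall (c : k) x, iE (c *: x) = c *: iE x)
  (HiD_add : forall x y, iD (x + y) = iD x + iD y)
  (HiD_mul : forall x y, iD (x * y) = iD x * iD y)
  (HiD1 : iD 1 = 1)
  (HiD_scal : forall (c : k) x, iD (c *: x) = c *: iD x)
  (Hcomm : forall x y, iE x * iD y = iD y * iE x)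
  (Htens_dim : \dim (@fullv _ Delta) = (\dim (@fullv _ E) * \dim (@fullv _ D))%N)
  (Htens_span : forall z : Delta, exists s : seq (E * D),
      z = \sum_(p <- s) iE p.1 * iD p.2)
  (* sigma' (x) rho and lambda~ on Delta *)
  (tau : Delta -> Delta)
  (Htau_add : forall z z', tau (z + z') = tau z + tau z')
  (Htau_t : forall x y, tau (iE x * iD y) = iE (sig' x) * iD (rho y))
  (lt : Delta -> D)
  (Hlt_add : forall z z', lt (z + z') = lt z + lt z')
  (Hlt_t : forall x y, lt (iE x * iD y) = (lam x)%:A * y)
  (* phi : E -> A = End_D(V), sigma'-sigma-equivariant k-algebra monomorphism *)
  (phi : E -> V -> V)
  (Hphi_Dlin : forall x u w a, phi x (u + act w a) = phi x u + act (phi x w) a)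
  (Hphi_add : forall x y u, phi (x + y) u = phi x u + phi y u)
  (Hphi_mul : forall x y u, phi (x * y) u = phi x (phi y u))
  (Hphi1 : forall u, phi 1 u = u)
  (Hphi_k : forall (c : k) u, phi (c%:A) u = act u (c%:A))
  (Hphi_inj : forall x, (forall u, phi x u = 0) -> x = 0)
  (Hphi_equiv : forall x u w, h (phi x u) w = h u (phi (sig' x) w))
  (* the resulting right Delta-vector space structure on V *)
  (actD : V -> Delta -> V)
  (HactD_add : forall u z z', actD u (z + z') = actD u z + actD u z')
  (HactD_t : forall u x y, actD u (iE x * iD y) = act (phi x u) y)
  (* h^phi *)
  (hphi : V -> V -> Delta)
  (Hhp_addl : forall u u' w, hphi (u + u') w = hphi u w + hphi u' w)
  (Hhp_addr : forall u w w', hphi u (w + w') = hphi u w + hphi u w')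
  (Hhp_sesq : forall u w a b, hphi (actD u a) (actD w b) = tau a * hphi u w * b)
  (Hhp_herm : forall u w, tau (hphi u w) = iD eps * hphi w u)
  (Hhp_lt : forall u w, lt (hphi u w) = h u w)
  (* the lattice M *)
  (M : V -> Prop)
  (HM_D : is_lattice act (int_ring v (R := D)) M)
  (HM_Delta : is_lattice actD (int_ring v (R := Delta)) M) :
  forall x : V,
    dual_lattice h (int_ideal v (R := D)) M x <->
    dual_lattice hphi (int_ideal v (R := Delta)) M x.
Proof.
have Ediv : forall x : E, x != 0 -> x \is a GRing.unit := @field_ext_div k E.
have vP := local_valuative Hk.
have [dimD4 [us [us_unit us_size us_central]]] :=
  involution_structure Hk HDdiv HDcent Hrho_add Hrho_mul Hrho1 Hrho2.
have dimD0 : (0 < \dim (@fullv _ D))%N by rewrite dimvf dim_falg_gt0.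
have cop := sqr_le4_coprime_odd dimD0 dimD4 HDdim HEodd.
have Cdiv := coprime_tensor_division HiE_add HiE_scal HiE_mul HiE1 HiD_add HiD_scal
  HiD_mul HiD1 Ediv HDdiv cop Htens_dim.
have wDP := nval_valuative Hk HDdiv; have wCP := nval_valuative Hk Cdiv.
have iE_int y : int_ring v (iE y) <-> int_ring v y.
  exact: (int_ring_hom HiE_add HiE_scal HiE_mul HiE1 Ediv v y).
have iD_int y : int_ring v (iD y) <-> int_ring v y.
  exact: (int_ring_hom HiD_add HiD_scal HiD_mul HiD1 HDdiv v y).
have iE0 : iE 0 = 0 by rewrite -[0 in LHS](scale0r 0) HiE_scal scale0r.
have iD0 : iD 0 = 0 by rewrite -[0 in LHS](scale0r 0) HiD_scal scale0r.
have lD a b : lam (a + b) = lam a + lam b.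
  by have := Hlam_lin 1 a b; rewrite scale1r mul1r.
have l0 : lam 0 = 0 by have := lD 0 0; rewrite addr0 -{1}[lam 0]addr0 => /addrI.
have lZ c a : lam (c *: a) = c * lam a.
  by have := Hlam_lin c a 0; rewrite !addr0 l0 addr0.
have lt0 : lt 0 = 0 by have := Hlt_add 0 0; rewrite addr0 -{1}[lt 0]addr0 => /addrI.
have span_ind (P : Delta -> Prop) : P 0 -> (forall a b, P a -> P b -> P (a + b)) ->
    (forall x y, P (iE x * iD y)) -> forall z, P z.
  move=> P0 PD Pt z; have [s ->] := Htens_span z.
  by elim/big_ind: _ => // p _; exact: Pt.
have lt_mulr z a : lt (z * iD a) = lt z * a.
  elim/span_ind: z => [|z z' hh hh'|x y]; first by rewrite !mul0r lt0 mul0r.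
    by rewrite mulrDl !Hlt_add hh hh' mulrDl.
  by rewrite -mulrA -HiD_mul !Hlt_t mulrA.
(* averaging over us projects Delta onto E, compatibly with lt and lam *)
have average z : exists e : E, \sum_(u <- us) iD u * z * iD u^-1 = iE e /\
    \sum_(u <- us) u * lt z * u^-1 = (lam e)%:A.
  elim/span_ind: z => [|z z' [e [he1 he2]] [e' [he1' he2']]|x y].
  - exists 0; rewrite iE0 lt0 l0 scale0r.
    by split; rewrite big1 // => u _; rewrite mulr0 mul0r.
  - exists (e + e'); rewrite HiE_add -he1 -he1' lD scalerDl -he2 -he2' Hlt_add -!big_split /=.
    by split; apply: eq_bigr => u _; rewrite mulrDr mulrDl.
  - have [c hc] := us_central y; exists (c *: x); split.
      have -> : iE (c *: x) = iE x * iD (c%:A).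
        by rewrite HiD_scal HiD1 HiE_scal -scalerAr mulr1.
      rewrite -hc; elim/big_ind2: _ => [|a a' b b' -> ->|u _]; first by rewrite iD0 mulr0.
        by rewrite HiD_add mulrDr.
      by rewrite mulrA -Hcomm -!mulrA -!HiD_mul.
    rewrite Hlt_t lZ mulrC -scalerA -hc scaler_sumr; apply: eq_bigr => u _.
    by rewrite mulr_algl -scalerAr -scalerAl.
(* The normalisation at y = 1 settles symmetric elements, and [lam_ideal] extends the result to all
   of p_E. *)
have lam_p e : vge (@nval k v E) 1 e -> vge v 1 (lam e).
  apply: (lam_ideal Hk Hsig'_add Hsig'_mul Hsig'1 Hsig'2 Hsig'k Hlam_lin Hlam_sig) => x sx hx.
  have /(Hlam_norm x sx)/(_ 1 Hsig'1) : int_ideal v x by apply/(int_idealP Hk Ediv).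
  rewrite mulr1 => hh; apply/val_idealP; apply: hh.
  by apply/(int_ringP Hk Ediv); exact: vge1 (nval_valuative Hk Ediv).
have iE_ideal e : vge (@nval k v Delta) 1 (iE e) -> vge (@nval k v E) 1 e.
  move/(int_idealP Hk Cdiv) => [/iE_int h1 h2]; apply/(int_idealP Hk Ediv); split=> //.
  move=> [eu /iE_int h3]; apply: h2.
  have e0 : iE e != 0.
    apply/eqP => /(hom_eq0 HiE_mul HiE1 Ediv) e0; move: eu; rewrite e0 unitr0; by [].
  split; first exact: Cdiv.
  have -> : (iE e)^-1 = iE e^-1.
    by apply: (mulrI (Cdiv _ e0)); rewrite divrr ?Cdiv // -HiE_mul divrr.
  exact: h3.
have lt_ideal z : vge (@nval k v Delta) 1 z -> vge (@nval k v D) 1 (lt z).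
  move=> hz; apply: contraT => hy.
  have y0 : lt z != 0 by apply: contraNneq hy => ->; exact: vge0.
  have aO : int_ring v (lt z)^-1.
    apply/(int_ringP Hk HDdiv); rewrite vge_ge ?invr_eq0 // (nvalV Hk HDdiv) // oppr_ge0.
    by move: hy; rewrite vge_ge // -ltNge -[1]add0r ltzD1.
  pose z' := z * iD (lt z)^-1.
  have hz' : vge (@nval k v Delta) 1 z'.
    by apply: (vgeM0r wCP) => //; apply/(int_ringP Hk Cdiv)/iD_int.
  have ltz' : lt z' = 1 by rewrite lt_mulr divrr ?HDdiv.
  have [e [he1 he2]] := average z'.
  have : vge (@nval k v E) 1 e.
    apply: iE_ideal; rewrite -he1 big_seq; apply: (vge_sum wCP) => u /us_unit uu.
    have uv : iD u * iD u^-1 = 1 by rewrite -HiD_mul divrr.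
    have iu0 : iD u != 0.
      by apply: contraTneq (oner_neq0 Delta) => hh; rewrite -uv hh mul0r eqxx.
    have iv0 : iD u^-1 != 0.
      by apply: contraTneq (oner_neq0 Delta) => hh; rewrite -uv hh mulr0 eqxx.
    have := wM wCP iu0 iv0; rewrite uv (w1 wCP) => wuv.
    apply: (@vge_le _ _ _ (nval v (iD u) + 1 + nval v (iD u^-1))).
      by rewrite addrAC -wuv add0r.
    by apply: (vgeM wCP); [apply: (vgeM wCP)|]; rewrite // vge_ge.
  move/lam_p => hle; move/negP: us_size; case.
  (* As [lt z'] is 1, each of the averaged terms u 1 u^-1 equals 1. *)
  suff <- : lam e = (size us)%:R by [].
  have : (lam e)%:A = ((size us)%:R : k)%:A :> D.
    rewrite -he2 ltz' scaler_nat -[RHS]/(1 *+ size us) -sum1_size.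
    rewrite -sumrMnr big_seq [RHS]big_seq; apply: eq_bigr => u /us_unit uu.
    by rewrite mulr1 divrr.
  by move/eqP; rewrite -subr_eq0 -scalerBl scaler_eq0 oner_eq0 orbF subr_eq0 => /eqP.
(* lam does not map o_E into p_k: test the normalisation at x = 1 *)
have [y0 [y0O y0l]] : exists y : E, int_ring v y /\ ~~ vge v 1 (lam y).
  apply: NNPP => hno.
  have [_ hh] := Hlam_norm 1 Hsig'1.
  have h1 : int_ring v (1 : E).
    by apply/(int_ringP Hk Ediv); exact: vge1 (nval_valuative Hk Ediv).
  have [|_ h2] := hh.
    move=> y _ yO; rewrite mul1r; apply/val_idealP; apply: contraT => hy.
    by case: hno; exists y.
  by apply: h2; rewrite unitr1 invr1.
have phiD x u w : phi x (u + w) = phi x u + phi x w.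
  by rewrite -[w]Hact1 Hphi_Dlin !Hact1.
have phi0 x : phi x 0 = 0.
  by have := phiD x 0 0; rewrite addr0 -{1}[phi x 0]addr0 => /addrI.
have phi_act x u a : phi x (act u a) = act (phi x u) a.
  by rewrite -[act u a]add0r Hphi_Dlin phi0 add0r.
have act0 u : act u 0 = 0.
  by have := Hact_addr u 0 0; rewrite addr0 -{1}[act u 0]addr0 => /addrI.
have actD0 u : actD u 0 = 0.
  by have := HactD_add u 0 0; rewrite addr0 -{1}[actD u 0]addr0 => /addrI.
(* The remaining module axioms of [actD] are checked on pure tensors, which generate Delta
   additively. *)
have actD_addl z u w : actD (u + w) z = actD u z + actD w z.
  elim/span_ind: z => [|z z' hh hh'|x y]; first by rewrite !actD0 addr0.
    by rewrite !HactD_add hh hh' addrACA.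
  by rewrite !HactD_t phiD Hact_addl.
have act0l a : act 0 a = 0.
  by have := Hact_addl 0 0 a; rewrite addr0 -{1}[act 0 a]addr0 => /addrI.
have actD0l z : actD 0 z = 0.
  by have := actD_addl z 0 0; rewrite addr0 -{1}[actD 0 z]addr0 => /addrI.
have actDM z z' u : actD (actD u z) z' = actD u (z * z').
  elim/span_ind: z' => [|a b hh hh'|x' y']; first by rewrite mulr0 !actD0.
    by rewrite mulrDr !HactD_add hh hh'.
  elim/span_ind: z => [|a b hh hh'|x y]; first by rewrite mul0r !actD0 actD0l.
    by rewrite mulrDl !HactD_add actD_addl hh hh'.
  have -> : iE x * iD y * (iE x' * iD y') = iE (x' * x) * iD (y * y').
    rewrite [x' * x]mulrC HiE_mul HiD_mul -!mulrA; congr (_ * _).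
    by rewrite !mulrA Hcomm.
  by rewrite !HactD_t phi_act HactM Hphi_mul.
have actD1 u : actD u 1 = u.
  by have := HactD_t u 1 1; rewrite HiE1 HiD1 mulr1 Hphi1 Hact1.
have tau1 : tau 1 = 1.
  by have := Htau_t 1 1; rewrite HiE1 HiD1 mulr1 Hsig'1 Hrho1 HiE1 HiD1 mulr1.
have M_stable m a : M m -> int_ring v a -> M (actD m a).
  have [s [hs _]] := HM_Delta; move=> /hs[b [bO ->]] aO; apply/hs.
  exists (fun i => b i * a); split.
    by move=> i; apply/(int_ringP Hk Cdiv)/(vgeM0l wCP); exact/(int_ringP Hk Cdiv).
  by elim/big_ind2: _ => // c c' d' d'' <- <-; rewrite actD_addl.
move=> x; split=> hx m Mm; last first.
  rewrite -Hhp_lt; apply/(int_idealP Hk HDdiv)/lt_ideal/(int_idealP Hk Cdiv).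
  exact: hx.
apply/(int_idealP Hk Cdiv); apply: contraT => hz; set z := hphi x m in hz.
have z0 : z != 0 by apply: contraNneq hz => ->; exact: vge0.
have zVO : vge (@nval k v Delta) 0 z^-1.
  rewrite vge_ge ?invr_eq0 // (nvalV Hk Cdiv) // oppr_ge0.
  by move: hz; rewrite vge_ge // -ltNge -[1]add0r ltzD1.
have aO : int_ring v (z^-1 * iE y0).
  apply/(int_ringP Hk Cdiv)/(vgeM0l wCP) => //.
  by apply/(int_ringP Hk Cdiv)/iE_int.
have := hx _ (M_stable m _ Mm aO).
have -> : h x (actD m (z^-1 * iE y0)) = (lam y0)%:A.
  rewrite -Hhp_lt -[x in hphi x _]actD1 Hhp_sesq tau1 mul1r -/z mulVKr ?Cdiv //.
  by have := Hlt_t y0 1; rewrite HiD1 !mulr1.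
move/(int_idealP Hk HDdiv); rewrite (vge_alg Hk HDdiv) => h1.
by rewrite h1 in y0l.
Qed.
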